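(* Let $n,k$ be integers with $1\le k\le n-1$. Then there exist real numbers $\xi_1,\dots,\xi_n\in[0,1)$ such that, writing $\xi=(1,\xi_1,\dots,\xi_n)$: (1) $1,\xi_1,\dots,\xi_n$ are linearly independent over $\mathbb{Z}$; (2) $\mu_k(\xi,N)\to 0$ as $N\to\infty$; (3) $\mu_{k+2}(\xi,N)\to\infty$ as $N\to\infty$.
   Context: Coordinates in $\mathbb{R}^{n+1}$ are $z=(x,y_1,\dots,y_n)$, and $|y|=\sqrt{y_1^2+\dots+y_n^2}$ for $y=(y_1,\dots,y_n)\in\mathbb{R}^n$. For a vector $\xi=(1,\xi_1,\dots,\xi_n)\in\mathbb{R}^{n+1}$ and a real $N\ge 1$ let $\mathcal{A}(\xi,N)$ be the linear map of $\mathbb{R}^{n+1}$ sending $(x,y_1,\dots,y_n)$ to $(N^{-1}x,\ N^{1/n}(\xi_1x-y_1),\dots,N^{1/n}(\xi_nx-y_n))$, and let $\Lambda(\xi,N)=\mathcal{A}(\xi,N)\mathbb{Z}^{n+1}$, a lattice in $\mathbb{R}^{n+1}$. Let $\mathcal{W}=\{(x,y)\in\mathbb{R}\times\mathbb{R}^n:\ \max(|x|,|y|)\le 1\}$. For $1\le l\le n+1$, $\mu_l(\xi,N)$ denotes the $l$-th successive minimum of $\mathcal{W}$ with respect to $\Lambda(\xi,N)$, i.e. the infimum of all $t>0$ such that $t\mathcal{W}$ contains $l$ linearly independent points of $\Lambda(\xi,N)$. Equivalently, $\mu_l(\xi,N)$ is the $l$-th successive minimum with respect to $\mathbb{Z}^{n+1}$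 of the cylinder $\{(x,y): |x|<N,\ (\sum_{j=1}^n|y_j-\xi_jx|^2)^{1/2}<N^{-1/n}\}$. *)

(* Defs.v *)
(** Parametric geometry of numbers for simultaneous approximation, over an
    arbitrary [realType] of MathComp-Analysis. *)
From HB Require Import structures.
From mathcomp Require Import all_boot all_order all_algebra.
From mathcomp Require Import all_classical all_reals all_analysis.

Set Implicit Arguments.
Unset Strict Implicit.
Unset Printing Implicit Defensive.

Import Order.TTheory GRing.Theory Num.Theory.
Import numFieldNormedType.Exports.

Local Open Scope classical_set_scope.
Local Open Scope ring_scope.

(* The library norm on matrices is the sup norm, hence this definition. *)
Definition enorm (R : realType) (n : nat) (y : 'rV[R]_n) : R :=
  Num.sqrt (\sum_(j < n) y 0 j ^+ 2).

(* A point z = (x, y) of R^(n+1) is a row of length 1 + n with x and y as its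
   left and right blocks. *)
Definition xcoord (R : realType) (n : nat) (z : 'rV[R]_(1 + n)) : R :=
  lsubmx z 0 0.

Definition ycoord (R : realType) (n : nat) (z : 'rV[R]_(1 + n)) : 'rV[R]_n :=
  rsubmx z.

Definition xypoint (R : realType) (n : nat) (x : R) (y : 'rV[R]_n) :
    'rV[R]_(1 + n) :=
  row_mx (\row_(_ < 1) x) y.

Definition approx_map (R : realType) (n : nat) (xi : 'rV[R]_(1 + n)) (N : R)
    (z : 'rV[R]_(1 + n)) : 'rV[R]_(1 + n) :=
  xypoint (N^-1 * xcoord z)
        (\row_(j < n) (N `^ n%:R^-1 * (ycoord xi 0 j * xcoord z - ycoord z 0 j))).

Definition int_points (R : realType) (m : nat) : set 'rV[R]_m :=
  range (fun q : 'rV[int]_m => map_mx intr q).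

Definition approx_lattice (R : realType) (n : nat) (xi : 'rV[R]_(1 + n))
    (N : R) : set 'rV[R]_(1 + n) :=
  approx_map xi N @` @int_points R (1 + n).

Definition unit_cylinder (R : realType) (n : nat) : set 'rV[R]_(1 + n) :=
  [set z | Num.max `|xcoord z| (enorm (ycoord z)) <= 1].

(* The rows of M are the l linearly independent points.  [inf set0] is 0, so the
   value is meaningful only when some t is admissible; for a full-rank lattice L
   and a neighbourhood W of 0 this holds for all l <= m. *)
Definition succ_min (R : realType) (m : nat) (W L : set 'rV[R]_m) (l : nat) : R :=
  inf [set t : R | 0 < t /\
    exists M : 'M[R]_(l, m), row_free M /\
      forall i : 'I_l, L (row i M) /\ [set t *: w | w in W] (row i M)].

Definition mu (R : realType) (n : nat) (l : nat) (xi : 'rV[R]_(1 + n)) (N : R) :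
    R :=
  succ_min (@unit_cylinder R n) (approx_lattice xi N) l.

Definition lin_indep_int (R : realType) (m : nat) (v : 'rV[R]_m) : Prop :=
  forall a : 'rV[int]_m, \sum_(i < m) (a 0 i)%:~R * v 0 i = 0 -> a = 0.

(* Main.v *)
(** xi is the limit of rational directions p = w / x(w) of integer points w.
    Write c = k - 1 and a = 4 ^ n.  Inside a rational subspace B of dimension k,
    run w_(j+k) = a w_(j+k-1) + w_j: any k consecutive points span B, and
    relative to the direction of a late point w_J the residues of w_j shrink by
    a factor 2 / a every c steps while x(w_j) grows by a factor at most a + 1
    per step.  As c <= n - 2, the quantity tau ^ (n-1) x(w_J), with tau the size
    of the residues near J, tends to 0.  At a late J jump out of B to
    w' = m w_J + v with v an integer point off B and m about 1 / tau, and go on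
    with the subspace B' spanned by w_(J-k+2), ..., w_J, w', so that B + B'
    has dimension k + 1.
    At all times N some k consecutive points of this sequence are short, which
    is (2); the choice m ~ 1 / tau keeps them short during the jump.  Integer
    points off B + B' stay at a fixed distance from it, while xi is as close to
    it as we please, the next jump coming arbitrarily late; so all moderately
    short points at time N lie in B + B', which is (3).  For (1), the s-th jump
    avoids the s-th rational hyperplane. *)

Require Import Defs.
From HB Require Import structures.
From mathcomp Require Import all_boot all_order all_algebra.
From mathcomp Require Import all_classical all_reals all_analysis.
From mathcomp Require Import ring lra zify.

Set Implicit Arguments.
Unset Strict Implicit.
Unset Printing Implicit Defensive.

Import Order.TTheory GRing.Theory Num.Theory.
Import numFieldNormedType.Exports.

Local Open Scope classical_set_scope.
Local Open Scope ring_scope.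

(** * Decay of solutions of a linear recurrence *)

(* Since a l_i = l_(i+1) - l_(i-c), a maximum principle on [0, J] bounds all |l_i|
   by 2 D, and the same identity then gains a factor 2 / a every c steps. *)
Lemma recurrence_decay (R : realFieldType) (l : nat -> R) (a D : R) (c J : nat) :
  4 <= a ->
  (forall j, l (j + c).+1 = a * l (j + c)%N + l j) ->
  (c <= J)%N -> l J = 0 ->
  (forall i, (i <= c)%N -> `|l i| <= D + `|l c|) ->
  forall s i, (s * c <= i <= J)%N -> `|l i| <= 2 * D * (2 / a) ^+ s.
Proof.
move=> a4 rec cJ lJ lD.
have a0 : 0 < a by lra.
have step V i : (c <= i <= J)%N ->
    (forall i', (i - c <= i' <= J)%N -> `|l i'| <= V) -> `|l i| <= 2 / a * V.
  move=> /andP[ci iJ] hV.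
  have V0 : 0 <= V by apply: le_trans (hV J _); rewrite ?normr_ge0 //; lia.
  have [->|iJ'] := eqVneq i J.
    by rewrite lJ normr0 !mulr_ge0 // invr_ge0 ltW.
  rewrite mulrAC ler_pdivlMr //.
  have -> : `|l i| * a = `|l i.+1 - l (i - c)%N|.
    have := rec (i - c)%N; rewrite subnK // => ->.
    by rewrite addrK normrM (gtr0_norm a0) mulrC.
  apply: le_trans (ler_normB _ _) _; rewrite mulrDl !mul1r lerD //; apply: hV; lia.
elim=> [|s IH] i.
  rewrite mul0n /= expr0 mulr1 => iJ.
  have [i0 _ hmax] := Order.TotalTheory.arg_maxP
    (fun i : 'I_J.+1 => `|l i|) (erefl : predT (ord0 : 'I_J.+1)).
  have hV i' : (i' <= J)%N -> `|l i'| <= `|l i0|.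
    by move=> i'J; apply: (hmax (Ordinal (i'J : i' < J.+1)%N)).
  apply: le_trans (hV _ iJ) _.
  (* As 2 / a is at most 1/2, a maximum attained beyond c is at most half of itself, hence zero; one
     attained at some i0 <= c is at most D plus half of itself. *)
  have half x : (c <= x <= J)%N -> `|l x| <= `|l i0| / 2.
    move=> cx; apply: le_trans (step `|l i0| _ cx _) _.
      by move=> i' /andP[_ ?]; apply: hV.
    rewrite [leRHS]mulrC; apply: ler_wpM2r => //.
    by rewrite ler_pdivrMr //; lra.
  have hc := half c; rewrite leqnn cJ in hc; have {}hc := hc isT.
  have D0 : 0 <= D by have := lD c (leqnn c); lra.
  have [i0c|ci0] := leqP i0 c; first by have := lD _ i0c; lra.
  have := half i0; rewrite (ltnW ci0) -ltnS ltn_ord => /(_ isT).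
  have := normr_ge0 (l i0); lra.
rewrite mulSn => /andP[si iJ]; rewrite exprS mulrCA.
by apply: step => [|i' h]; [lia | apply: IH; lia].
Qed.

(** * Integer linear algebra *)

(** The columns of F are a rational basis-free description of the orthogonal of W: the kernel matrix
    of the transpose, with all denominators cleared by their product d. Rank does not change from
    the rationals to R. *)
Lemma int_annihilator (R : numFieldType) r c (W : 'M[int]_(r, c)) :
  exists F : 'M[int]_c,
    W *m F = 0 /\ (c <= \rank (map_mx intr F : 'M[R]_c) + r)%N.
Proof.
pose Wq : 'M[rat]_(r, c) := map_mx intr W.
pose K := (kermx Wq^T)^T.
pose d := \prod_i \prod_j denq (K i j).
have d0 : d%:Q != 0.
  rewrite intr_eq0; apply/prodf_neq0 => i _; apply/prodf_neq0 => j _.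
  exact: denq_neq0.
have dK i j : d%:Q * K i j \is a Num.int.
  rewrite /d (bigD1 i) //= (bigD1 j) //= -!mulrA intrM mulrAC.
  by rewrite [_ * K i j]mulrC -numqE -intrM intr_int.
pose F := \matrix_(i, j) numq (d%:Q * K i j).
have FE : map_mx intr F = d%:Q *: K.
  apply/matrixP => i j; rewrite [LHS]mxE [F i j]mxE [RHS]mxE.
  by have /intrP[x ->] := dK i j; rewrite numq_int.
exists F; split.
  suff /matrixP H : map_mx intr (W *m F) = 0 :> 'M[rat]_(r, c).
    apply/matrixP => i j; have /eqP := H i j.
    by rewrite mxE [in X in _ == X]mxE intr_eq0 [RHS]mxE => /eqP.
  rewrite map_mxM FE -scalemxAr.
  by rewrite -[_ *m K]trmxK trmx_mul trmxK mulmx_ker trmx0 scaler0.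
have -> : \rank (map_mx intr F : 'M[R]_c) = \rank (map_mx intr F : 'M[rat]_c).
  rewrite -(mxrank_map (ratr : rat -> R)); congr (\rank _).
  by apply/matrixP => i j; rewrite !mxE /= ratr_int.
rewrite FE mxrank_scale_nz // mxrank_tr mxrank_ker mxrank_tr.
by have := rank_leq_row Wq; lia.
Qed.

(** Some basis vector e_i is off W and some e_l is off the kernel of phi; if neither has both
    properties, e_i + e_l does. Entries 0 and 1 later keep the change of direction in a jump below 1
    / x(w'). *)
Lemma int_vector_avoiding (R : numFieldType) r c (W : 'M[R]_(r, c))
    (phi : 'cV[int]_c) :
  (r < c)%N -> phi != 0 ->
  exists v : 'rV[int]_c,
    [/\ forall i, (v 0 i == 0) || (v 0 i == 1),
        ~~ (map_mx intr v <= W)%MS & v *m phi != 0].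
Proof.
move=> rc phi0.
pose e i : 'rV[int]_c := delta_mx 0 i.
have [i eW] : exists i, ~~ (map_mx intr (e i) <= W)%MS.
  apply/existsP; rewrite -negb_forall; apply/negP => /forallP H.
  have : (1%:M <= W)%MS.
    apply/row_subP => i; rewrite row1; have := H i.
    by rewrite /e map_delta_mx.
  by move/mxrankS; rewrite mxrank1 leqNgt (leq_ltn_trans (rank_leq_row _)).
have [l phil] : exists l, e l *m phi != 0.
  apply/existsP; rewrite -negb_forall; apply/negP => /forallP H.
  case/eqP: phi0; apply/row_matrixP => j; rewrite row0 rowE; exact/eqP/H.
have e01 j x : (e j 0 x == 0) || (e j 0 x == 1).
  by rewrite mxE; case: (_ && _).
have [phii|phii] := eqVneq (e i *m phi) 0; last by exists (e i).
have [lW|lW] := boolP (map_mx intr (e l) <= W)%MS; last by exists (e l).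
exists (e i + e l); split.
- have il : i != l by apply: contraNneq phil => <-; rewrite phii.
  move=> x; rewrite !mxE eqxx /=; have [->|xi] := eqVneq x i.
    by rewrite (negPf il) addr0 eqxx orbT.
  by case: (x == l).
- apply: contra eW => H; rewrite -(addrK (e l) (e i)) map_mxB.
  by rewrite addmx_sub // eqmx_opp.
- by rewrite mulmxDl phii add0r.
Qed.

(** * Recurrent sequences and the spans of consecutive terms *)

(** A shift register: the state holds c + 1 consecutive terms, and the sequence is read off at entry
    0. *)
Lemma recurrence_exists (V : nmodType) (a c : nat) (u : nat -> V) :
  exists w : nat -> V, (forall i, (i <= c)%N -> w i = u i) /\
    forall j, w (j + c).+1 = w (j + c)%N *+ a + w j.
Proof.
pose next (f : nat -> V) i := if (i < c)%N then f i.+1 else f c *+ a + f 0%N.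
pose g j := iter j next u.
have gE i j : (i <= c)%N -> g j i = g (j + i)%N 0%N.
  elim: i j => [|i IH] j ic; first by rewrite addn0.
  by rewrite addnS -addSn -IH ?(ltnW ic) // [RHS]/(next (g j) i) /next ic.
exists (fun j => g j 0%N); split=> [i ic|j]; first by rewrite -(add0n i) -gE.
by rewrite -addSn -!gE // [LHS]/(next (g j) c) /next ltnn.
Qed.

Definition window (R : Type) m c (w : nat -> 'rV[R]_m) (j : nat) : 'M[R]_(c, m) :=
  \matrix_(i < c) w (j + i)%N.

Lemma row_window (R : Type) m c (w : nat -> 'rV[R]_m) j i :
  row i (window c w j) = w (j + i)%N.
Proof. exact: rowK. Qed.

Lemma sub_window (R : fieldType) m c (w : nat -> 'rV[R]_m) j i :
  (j <= i < j + c)%N -> (w i <= window c w j)%MS.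
Proof.
move=> ji; have ic : (i - j < c)%N by lia.
rewrite -[w i](_ : row (Ordinal ic) (window c w j) = _) ?row_sub //.
by rewrite row_window /= subnKC //; lia.
Qed.

(** The recurrence can be solved for w_j, so the window at j + 1 still spans w_j. For c = 0 it reads
    w_(j+1) = (a + 1) w_j, which may vanish in positive characteristic; hence the restriction to j =
    0. *)
Lemma row_free_window_rec (R : fieldType) m c (w : nat -> 'rV[R]_m) (a : nat) :
  (forall j, w (j + c).+1 = w (j + c)%N *+ a + w j) ->
  row_free (window c.+1 w 0) ->
  forall j, (0 < c)%N || (j == 0)%N -> row_free (window c.+1 w j).
Proof.
move=> rec w0; elim=> [//|j IH]; rewrite orbF => c0.
have := IH; rewrite c0 => /(_ isT); rewrite /row_free => /eqP wj.
rewrite eqn_leq rank_leq_row -{1}wj mxrankS //; apply/row_subP => i.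
rewrite row_window; have [i0|i0] := posnP i; last first.
  by rewrite sub_window //; case: i i0 => i ? /=; lia.
rewrite i0 addn0 -(addKr (w (j + c)%N *+ a) (w j)) -rec addrC.
rewrite addmx_sub ?sub_window //; try lia.
rewrite eqmx_opp -scaler_nat scalemx_sub // sub_window //; lia.
Qed.

(* The new window together with w_j spans both the old window and v. *)
Lemma row_free_window_jump (R : fieldType) m c (w u : nat -> 'rV[R]_m) j
    (a : nat) (v : 'rV[R]_m) :
  row_free (window c.+1 w j) -> ~~ (v <= window c.+1 w j)%MS ->
  (forall i, (i < c)%N -> u i = w (j + i).+1) -> u c = w (j + c)%N *+ a + v ->
  row_free (window c.+1 u 0).
Proof.
move=> wj vj uw uc.
have wsub i : (i < c.+1)%N -> (w (j + i)%N <= window c.+1 u 0 + w j)%MS.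
  case: i => [|i] ic; first by rewrite addn0 addsmxSr.
  rewrite addnS -uw // (submx_trans _ (addsmxSl _ _)) // sub_window //; lia.
have vsub : (v <= window c.+1 u 0 + w j)%MS.
  rewrite -(addKr (w (j + c)%N *+ a) v) -uc addmx_sub //.
    by rewrite eqmx_opp -scaler_nat scalemx_sub // wsub.
  by rewrite (submx_trans _ (addsmxSl _ _)) // sub_window //; lia.
have /mxrankS : (window c.+1 w j + v <= window c.+1 u 0 + w j)%MS.
  rewrite addsmx_sub vsub andbT; apply/row_subP => i.
  by rewrite row_window wsub.
have : (window c.+1 w j < window c.+1 w j + v)%MS.
  by rewrite /ltmx addsmxSl /= addsmx_sub submx_refl.
move/rank_ltmx => h1 h2.
have h3 := mxrank_adds_leqif (window c.+1 u 0) (w j).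
have := leq_trans h2 h3.1; have := rank_leq_row (w j).
move: wj h1; rewrite /row_free => /eqP -> h1 h4 h5.
rewrite eqn_leq rank_leq_row; lia.
Qed.

Lemma normr_mulmx_le (R : numDomainType) r c (z : 'rV[R]_r) (F : 'M[R]_(r, c)) b l :
  (forall i, `|z 0 i| <= b) ->
  `|(z *m F) 0 l| <= (\sum_i \sum_j `|F i j|) * b.
Proof.
move=> zb; rewrite mxE mulr_suml; apply: le_trans (ler_norm_sum _ _ _) _.
apply: ler_sum => i _; rewrite normrM mulrC ler_pM //.
by rewrite (bigD1 l) //= lerDl sumr_ge0.
Qed.

(** * Growth of the heights against decay of the residues *)

Section Recurrence.
Variables (R : realFieldType) (x : nat -> R) (a c : nat).
Hypothesis x0 : 0 < x 0%N.
Hypothesis xmono : forall i, (i < c)%N -> x i <= x i.+1.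
Hypothesis rec : forall j, x (j + c).+1 = x (j + c)%N *+ a + x j.
Hypothesis a0 : (0 < a)%N.

Lemma rec_gt0_le j : 0 < x j /\ x j <= x j.+1.
Proof.
elim/ltn_ind: j => j IH.
have xj : 0 < x j.
  by case: j IH => // j /(_ j (ltnSn j)) [xj]; apply: lt_le_trans.
split=> //; have [/xmono//|cj] := ltnP j c.
rewrite -{2}(subnK cj) rec subnK //.
have [E|jc] := eqVneq (j - c)%N j.
  by rewrite E lerDr mulrn_wge0 // ltW.
have /IH[h _] : (j - c < j)%N by lia.
rewrite -[leLHS]addr0 lerD // ?(ltW h) //.
by rewrite -mulr_natl ler_peMl ?ler1n // ltW.
Qed.

Lemma rec_gt0 j : 0 < x j. Proof. by case: (rec_gt0_le j). Qed.

Lemma rec_le i j : (i <= j)%N -> x i <= x j.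
Proof.
by apply: (homo_leq (@lexx _ _) (@le_trans _ _)) => k; case: (rec_gt0_le k).
Qed.

Lemma rec_growth t : x (c + t)%N <= (a%:R + 1) ^+ t * x c.
Proof.
elim: t => [|t IH]; first by rewrite addn0 expr0 mul1r.
rewrite addnS (addnC c t) rec exprS -mulrA.
apply: le_trans (_ : (a%:R + 1) * x (c + t)%N <= _).
  by rewrite mulrDl mul1r mulr_natl (addnC c t) lerD2l rec_le // leq_addr.
by apply: ler_wpM2l => //; rewrite addr_ge0.
Qed.

End Recurrence.

(** In c steps residues shrink by 2 / a and heights grow by at most (a + 1)^c <= (2 a)^c. Since c +
    1 <= n - 1, the left side is at most 2^(n-1+c) / a, and a = 4^n exceeds 2^(n+c). *)
Lemma contraction (R : realFieldType) (n c : nat) : (c + 2 <= n)%N ->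
  (2 / (4 ^ n)%:R) ^+ n.-1 * ((4 ^ n)%:R + 1) ^+ c <= 2^-1 :> R.
Proof.
move=> cn; set a : R := (4 ^ n)%:R.
have a1 : 1 <= a by rewrite ler1n expn_gt0.
have a0 : 0 < a by lra.
rewrite expr_div_n mulrAC ler_pdivrMr ?exprn_gt0 //.
have h1 : (a + 1) ^+ c <= 2 ^+ c * a ^+ c.
  by rewrite -exprMn lerXn2r // ?nnegrE; lra.
have h2 : a ^+ c * a <= a ^+ n.-1.
  by rewrite -exprSr ler_weXn2l //; lia.
have h3 : 2 ^+ n.-1 * 2 ^+ c * 2 <= a.
  rewrite /a -exprD -exprSr -natrX ler_nat -(expnM 2 2) leq_exp2l //; lia.
rewrite [leRHS]mulrC ler_pdivlMr //.
apply: le_trans (_ : a ^+ c * (2 ^+ n.-1 * 2 ^+ c * 2) <= _).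
  rewrite [leRHS](_ : _ = 2 ^+ n.-1 * (2 ^+ c * a ^+ c) * 2); last by ring.
  by rewrite ler_pM2r // ler_wpM2l // exprn_ge0.
by apply: le_trans h2; rewrite ler_wpM2l // exprn_ge0 // ltW.
Qed.

(** Both quantities are at most C / 2^t: the first since 2 / a <= 1/2, the second by t applications
    of [contraction]. *)
Lemma exists_small_scale (R : realType) (x : nat -> R) (D th : R) (n c : nat) :
  (c + 2 <= n)%N -> 0 < D -> 0 < th -> 0 < x c ->
  (forall t, x (c + t)%N <= ((4 ^ n)%:R + 1) ^+ t * x c) ->
  exists t, 2 * D * (2 / (4 ^ n)%:R) ^+ t <= th /\
    (2 * D * (2 / (4 ^ n)%:R) ^+ t) ^+ n.-1 * x (t.+1 * c)%N <= th.
Proof.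
move=> cn D0 th0 xc0 xg.
set a : R := (4 ^ n)%:R in xg *.
have a4 : 4 <= a.
  by rewrite ler_nat -[X in (X <= _)%N]expn1 leq_exp2l //; lia.
have r0 : 0 <= 2 / a by rewrite divr_ge0 //; lra.
have r2 : 2 / a <= 2^-1 by rewrite ler_pdivrMr; lra.
pose C := 2 * D + (2 * D) ^+ n.-1 * x c.
have C0 : 0 < C by rewrite addr_gt0 ?mulr_gt0 ?exprn_gt0 ?mulr_gt0.
(* C / th < t + 1 <= 2^t. *)
pose t := Num.truncn (C / th).
have Ct : C * 2^-1 ^+ t <= th.
  rewrite exprVn ler_pdivrMr ?exprn_gt0 // mulrC -ler_pdivrMr //.
  apply: le_trans (ltW (truncnS_gt _)) _.
  by rewrite -natrX ler_nat ltn_expl.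
have p0 : 0 <= 2^-1 ^+ t :> R by rewrite exprn_ge0.
exists t; split.
  apply: le_trans Ct; apply: ler_pM; rewrite ?exprn_ge0 //; first lra.
    by rewrite lerDl mulr_ge0 ?exprn_ge0 //; lra.
  by rewrite lerXn2r // nnegrE.
apply: le_trans (_ : (2 * D) ^+ n.-1 * x c *
  ((2 / a) ^+ n.-1 * (a + 1) ^+ c) ^+ t <= _).
  rewrite mulSn exprMn [leRHS](_ : _ =
    (2 * D) ^+ n.-1 * ((2 / a) ^+ t) ^+ n.-1 * ((a + 1) ^+ (t * c) * x c)).
    by rewrite ler_wpM2l // mulr_ge0 // !exprn_ge0 //; lra.
  rewrite [X in _ * X = _]exprMn -!exprM (mulnC n.-1) (mulnC c t).
  by ring.
apply: le_trans Ct; apply: ler_pM.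
- by rewrite mulr_ge0 ?exprn_ge0 //; lra.
- by rewrite exprn_ge0 // mulr_ge0 ?exprn_ge0 //; lra.
- by rewrite /C lerDr; lra.
- rewrite lerXn2r ?nnegrE //; last exact: contraction.
  by rewrite mulr_ge0 ?exprn_ge0 //; lra.
Qed.

Section Orbit.
Variables (R : realFieldType) (x y : nat -> R) (a c : nat) (D : R).
Hypothesis a4 : (4 <= a)%N.
Hypothesis x0 : 0 < x 0%N.
Hypothesis xmono : forall i, (i < c)%N -> x i <= x i.+1.
Hypothesis xrec : forall j, x (j + c).+1 = x (j + c)%N *+ a + x j.
Hypothesis yrec : forall j, y (j + c).+1 = y (j + c)%N *+ a + y j.
Hypothesis yD : forall i, (i <= c)%N -> `|y i - x i * (y c / x c)| <= D.

(** The residue relative to the direction of w_J is a linear combination of x and y, so it obeys the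
    same recurrence, and it vanishes at J. *)
Lemma orbit_resid J s i : (c <= J)%N -> (s * c <= i <= J)%N ->
  `|y i - x i * (y J / x J)| <= 2 * D * (2 / a%:R) ^+ s.
Proof.
move=> cJ siJ.
have a0 : (0 < a)%N by lia.
have xp k : 0 < x k by exact: (rec_gt0 x0 xmono xrec a0).
apply: (recurrence_decay (l := fun i => y i - x i * (y J / x J)) _ _ cJ) siJ.
- by rewrite ler_nat.
- by move=> j /=; rewrite xrec yrec -(mulr_natl (x _)) -(mulr_natl (y _)); ring.
- by rewrite /= mulrC divfK ?subrr // gt_eqF.
- move=> k kc /=.
  have -> : y k - x k * (y J / x J) = y k - x k * (y c / x c) +
      x k / x c * (y c - x c * (y J / x J)).
    by field; rewrite !gt_eqF.
  apply: le_trans (ler_normD _ _) _; rewrite lerD ?yD // normrM ler_piMl //.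
  rewrite gtr0_norm ?divr_gt0 // ler_pdivrMr // mul1r.
  exact: (rec_le x0 xmono xrec a0).
Qed.

Lemma orbit_center J : (c <= J)%N -> `|y c / x c - y J / x J| <= 2 * D / x c.
Proof.
move=> cJ; have a0 : (0 < a)%N by lia.
have xp k : 0 < x k by exact: (rec_gt0 x0 xmono xrec a0).
rewrite ler_pdivlMr //; have := @orbit_resid J 0 c cJ.
rewrite mul0n cJ /= => /(_ isT); rewrite expr0 mulr1; apply: le_trans.
have -> : y c - x c * (y J / x J) = (y c / x c - y J / x J) * x c.
  by field; rewrite !gt_eqF.
by rewrite normrM (gtr0_norm (xp c)).
Qed.

End Orbit.

Lemma mul_le_of_exp (R : realFieldType) (n : nat) (L P X e e' : R) :
  (0 < n)%N -> 0 <= L -> 0 <= P -> 0 < e -> 0 < e' ->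
  P ^+ n <= X / e' -> L ^+ n * X <= e' * e ^+ n -> L * P <= e.
Proof.
move=> n0 L0 P0 e0 e'0 PX LX.
rewrite -(ler_pXn2r n0) ?nnegrE ?mulr_ge0 ?(ltW e0) // exprMn.
apply: le_trans (_ : L ^+ n * (X / e') <= _).
  by rewrite ler_wpM2l // exprn_ge0.
by rewrite mulrA ler_pdivrMr // [leRHS]mulrC.
Qed.

(* Covers the times N between x_c / e and x_J / e. *)
Lemma early_bound (R : realFieldType) (x : nat -> R) (n c t i : nat)
    (D L P e : R) :
  let a := (4 ^ n)%:R in
  (c + 2 <= n)%N -> (i < t.+1 * c)%N -> 0 < D -> 0 <= P -> 0 < e -> 0 < x c ->
  (forall t, x (c + t)%N <= (a + 1) ^+ t * x c) ->
  6 ^+ n * (a + 1) ^+ n * D ^+ n * x c <= e ^+ n.+1 ->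
  0 <= L ->
  L <= 2 * D * (2 / a) ^+ (i %/ c) + 2 * (2 * D * (2 / a) ^+ t) ->
  P ^+ n <= x (c + i.+1)%N / e -> L * P <= e.
Proof.
move=> a cn it D0 P0 e0 xc0 xg De L0 LD Px.
have c0 : (0 < c)%N by clear -it; case: c it => //; rewrite muln0.
have a4 : 4 <= a.
  by rewrite ler_nat -[X in (X <= _)%N]expn1 leq_exp2l //; clear -cn; lia.
have r0 : 0 <= 2 / a by rewrite divr_ge0 //; lra.
have r1 : 2 / a <= 1 by rewrite ler_pdivrMr; lra.
set s := (i %/ c)%N in LD.
have st : (s <= t)%N by rewrite -ltnS /s ltn_divLR.
have is1 : (i.+1 <= s.+1 * c)%N by exact: ltn_ceil.
(* As s <= t, the term in t, which is the cost of replacing p by xi, is absorbed: 6 = 2 + 4. *)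
have {}LD : L <= 6 * D * (2 / a) ^+ s.
  have : (2 / a) ^+ t <= (2 / a) ^+ s by apply: ler_wiXn2l.
  have : 0 <= (2 / a) ^+ t by rewrite exprn_ge0.
  move: LD; set u := _ ^+ t; set v := _ ^+ s; nra.
have n0 : (0 < n)%N by clear -cn; lia.
apply: (mul_le_of_exp n0 L0 P0 e0 e0 Px).
rewrite -exprS; apply: le_trans De.
apply: le_trans (_ : (6 * D * (2 / a) ^+ s) ^+ n * ((a + 1) ^+ (s.+1 * c) * x c) <= _).
  apply: ler_pM.
  - by rewrite exprn_ge0.
  - by have := le_trans (exprn_ge0 n P0) Px; rewrite pmulr_lge0 ?invr_gt0.
  - by rewrite lerXn2r // nnegrE (le_trans L0).
  - apply: le_trans (xg _) _; rewrite ler_wpM2r ?(ltW xc0) //.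
    by rewrite ler_weXn2l //; lra.
(* Grouping by s leaves the s-th power of a number at most 1 by [contraction]. *)
have -> : (6 * D * (2 / a) ^+ s) ^+ n * ((a + 1) ^+ (s.+1 * c) * x c) =
    6 ^+ n * (a + 1) ^+ c * D ^+ n * x c * ((2 / a) ^+ n * (a + 1) ^+ c) ^+ s.
  rewrite !exprMn -!exprM mulSn exprD (mulnC c s) (mulnC n s); ring.
have h0 : 0 <= (2 / a) ^+ n * (a + 1) ^+ c.
  by rewrite mulr_ge0 // exprn_ge0 //; lra.
have h1 : (2 / a) ^+ n * (a + 1) ^+ c <= 1.
  apply: le_trans (_ : 2^-1 <= 1); last by lra.
  apply: le_trans (contraction R cn); rewrite ler_wpM2r ?exprn_ge0 //; try lra.
  by apply: ler_wiXn2l => //; exact: leq_pred.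
apply: le_trans (_ : 6 ^+ n * (a + 1) ^+ c * D ^+ n * x c <= _).
  by rewrite ler_piMr ?exprn_ile1 // !mulr_ge0 ?exprn_ge0 //; lra.
rewrite !ler_wpM2r ?exprn_ge0 ?(ltW xc0) ?(ltW D0) // ler_wpM2l ?exprn_ge0 //.
by rewrite ler_weXn2l //; [lra | clear -cn; lia].
Qed.

(** * Residues, short points and confinement to a rational subspace *)

Section Geometry.
Variables (R : realType) (n : nat).
Implicit Types (z : 'rV[R]_(1 + n)) (xi eta : 'rV[R]_n).

Definition residue xi z : 'rV[R]_n := ycoord z - xcoord z *: xi.

Definition direction z : 'rV[R]_n := (xcoord z)^-1 *: ycoord z.

Definition within xi eta (b : R) := forall j, `|xi 0 j - eta 0 j| <= b.

Definition form_size r c (F : 'M[int]_(r, c)) : R :=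
  \sum_i \sum_j `|(F i j)%:~R|.

(* The time parameter P stands for the n-th root of N. *)
Definition short_points (l : nat) xi (P b : R) :=
  exists Q : 'M[int]_(l, 1 + n), row_free (map_mx intr Q : 'M[R]_(l, 1 + n)) /\
    forall i, let z := row i (map_mx intr Q) in
      `|xcoord z| <= b * P ^+ n /\ forall j, `|residue xi z 0 j| * P <= b.

(** The confining subspace, of dimension at most r, is given as the kernel of an integer matrix: the
    integrality of q F is what separates other integer points from it. *)
Definition confined (r : nat) xi (P b : R) :=
  exists F : 'M[int]_(1 + n), (1 + n <= \rank (map_mx intr F : 'M[R]_(1 + n)) + r)%N /\
    forall q : 'rV[int]_(1 + n), let z := map_mx intr q in
      `|xcoord z| <= b * P ^+ n -> (forall j, `|residue xi z 0 j| * P <= b) ->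
      q *m F = 0.

Lemma xcoordE z : xcoord z = z 0 (lshift n 0).
Proof. by rewrite /xcoord mxE. Qed.

Lemma ycoordE z j : ycoord z 0 j = z 0 (rshift 1 j).
Proof. by rewrite /ycoord mxE. Qed.

Lemma residueE xi z j : residue xi z 0 j = ycoord z 0 j - xcoord z * xi 0 j.
Proof. by rewrite !mxE. Qed.

Lemma directionE z j : direction z 0 j = ycoord z 0 j / xcoord z.
Proof. by rewrite mxE mulrC. Qed.

Lemma xcoord_xypoint x xi : xcoord (xypoint x xi) = x.
Proof. by rewrite /xcoord /xypoint row_mxKl mxE. Qed.

Lemma ycoord_xypoint x xi : ycoord (xypoint x xi) = xi.
Proof. by rewrite /ycoord /xypoint row_mxKr. Qed.

Lemma xypoint_coords z : xypoint (xcoord z) (ycoord z) = z.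
Proof.
rewrite -[RHS]hsubmxK /xypoint; congr (row_mx _ _).
by apply/rowP => i; rewrite ord1 mxE.
Qed.

Lemma scale_xypoint_direction z : xcoord z != 0 ->
  xcoord z *: xypoint 1 (direction z) = z.
Proof.
move=> z0; rewrite -[RHS]xypoint_coords /xypoint scale_row_mx; congr (row_mx _ _).
  by apply/rowP => i; rewrite !mxE mulr1.
by rewrite scalerA divff // scale1r.
Qed.

Lemma sub_xypoint xi z :
  z - xcoord z *: xypoint 1 xi = xypoint 0 (residue xi z).
Proof.
rewrite -{1}[z]xypoint_coords /xypoint scale_row_mx opp_row_mx add_row_mx.
by congr (row_mx _ _); apply/rowP => i; rewrite !mxE mulr1 subrr.
Qed.

Lemma normr_xypoint_le x xi (b : R) : `|x| <= b -> (forall j, `|xi 0 j| <= b) ->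
  forall i, `|xypoint x xi 0 i| <= b.
Proof.
move=> xb yb i; rewrite /xypoint mxE.
by case: splitP => j _; rewrite ?mxE.
Qed.

Lemma form_size_ge0 r c (F : 'M[int]_(r, c)) : 0 <= form_size F.
Proof. by rewrite !sumr_ge0 // => i _; rewrite sumr_ge0. Qed.

Lemma residue_change xi eta z (b d : R) j :
  `|residue eta z 0 j| <= b -> within xi eta d ->
  `|residue xi z 0 j| <= b + `|xcoord z| * d.
Proof.
rewrite !residueE => zb xd.
have -> : ycoord z 0 j - xcoord z * xi 0 j = ycoord z 0 j - xcoord z * eta 0 j -
   xcoord z * (xi 0 j - eta 0 j) by ring.
by apply: le_trans (ler_normB _ _) _; rewrite lerD // normrM ler_wpM2l.
Qed.

Lemma intr_mulmx_le c (F : 'M[int]_(1 + n, c)) z (b : R) l :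
  (forall i, `|z 0 i| <= b) -> `|(z *m map_mx intr F) 0 l| <= form_size F * b.
Proof.
move=> zb; apply: le_trans (normr_mulmx_le _ l zb) _.
rewrite /form_size (_ : (\sum_i \sum_j `|_|) = \sum_i \sum_j `|(F i j)%:~R|) //.
by apply: eq_bigr => i _; apply: eq_bigr => j _; rewrite mxE.
Qed.

Lemma direction_mulmx c (w : 'rV[int]_(1 + n)) (F : 'M[int]_(1 + n, c)) :
  xcoord (map_mx intr w : 'rV[R]_(1 + n)) != 0 -> w *m F = 0 ->
  xypoint 1 (direction (map_mx intr w)) *m map_mx intr F = 0 :> 'rV[R]_c.
Proof.
set z := map_mx intr w => z0 wF.
apply: (scalerI z0); rewrite scaler0 scalemxAl scale_xypoint_direction //.
by rewrite -map_mxM wF map_mx0.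
Qed.

(* An integer point off the kernel of F has an entry of F q at least 1 in
   absolute value, so it stays at a fixed distance from that kernel. *)
Lemma confined_near r xi (w : 'rV[int]_(1 + n)) (F : 'M[int]_(1 + n)) (P b d : R) :
  let eta := direction (map_mx intr w) in
  (1 + n <= \rank (map_mx intr F : 'M[R]_(1 + n)) + r)%N ->
  xcoord (map_mx intr w : 'rV[R]_(1 + n)) != 0 -> w *m F = 0 ->
  0 < P -> 0 <= b -> 0 <= d ->
  2 * form_size F * b < P -> 2 * (form_size F * b * P ^+ n * d) < 1 ->
  within xi eta d -> confined r xi P b.
Proof.
move=> eta rF w0 wF P0 b0 d0 FP Fd xd; exists F; split=> // q z xq yq.
have z1 j : `|residue eta z 0 j| <= b / P + b * P ^+ n * d.
  apply: le_trans (residue_change (xi := eta) (eta := xi) (b := b / P) (d := d) _ _) _.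
  - by rewrite ler_pdivlMr //; apply: yq.
  - by move=> j'; rewrite distrC.
  - by rewrite lerD2l ler_wpM2r.
apply/rowP => l; rewrite [RHS]mxE.
(* F kills (1, eta), so only the residue of z about eta contributes to z F. *)
have zF : map_mx intr (q *m F) = xypoint 0 (residue eta z) *m map_mx intr F :> 'rV[R]_(1 + n).
  rewrite map_mxM -sub_xypoint mulmxBl -scalemxAl direction_mulmx //.
  by rewrite scaler0 subr0.
have : `|(map_mx intr (q *m F) : 'rV[R]_(1 + n)) 0 l| < 1.
  rewrite zF; apply: le_lt_trans (intr_mulmx_le _ _ (normr_xypoint_le _ z1)) _.
    by rewrite normr0 addr_ge0 // ?mulr_ge0 // ?exprn_ge0 ?invr_ge0 ?(ltW P0).
  have : form_size F * (b / P) < 2^-1.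
    by rewrite mulrA ltr_pdivrMr //; lra.
  by rewrite mulrDr; lra.
by rewrite mxE -intr_norm ltrz1 -[1]add0r ltzD1 normr_le0 => /eqP.
Qed.
End Geometry.

Lemma interval_index (R : realDomainType) (x : nat -> R) (y : R) c J :
  (c <= J)%N -> x c <= y ->
  x J <= y \/ exists i, [/\ (c <= i < J)%N, x i <= y & y <= x i.+1].
Proof.
move=> cJ xc; elim: J cJ => [|J IH]; first by rewrite leqn0 => /eqP <-; left.
rewrite leq_eqVlt => /predU1P[<-|]; first by left.
rewrite ltnS => cJ; case: (IH cJ) => [xJ|[i [iJ xi yi]]]; last first.
  by right; exists i; split=> //; lia.
by case: (leP (x J.+1) y) => h; [left | right; exists J; split=> //; [lia | exact: ltW]].
Qed.

(** * Sequences of integer points *)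

Section Points.
Variables (R : realType) (n : nat).
Implicit Types (w : nat -> 'rV[int]_(1 + n)) (xi : 'rV[R]_n).

Definition rpt w i : 'rV[R]_(1 + n) := map_mx intr (w i).

Lemma map_window w c j : map_mx intr (window c w j) = window c (rpt w) j.
Proof. by apply/matrixP => i l; rewrite !mxE. Qed.

Lemma short_points_window w c j xi (P b : R) :
  row_free (window c (rpt w) j) ->
  (forall q, (j <= q < j + c)%N -> `|xcoord (rpt w q)| <= b * P ^+ n /\
     forall l, `|residue xi (rpt w q) 0 l| * P <= b) ->
  short_points c xi P b.
Proof.
move=> wf H; exists (window c w j); rewrite map_window; split=> // i.
by rewrite row_window; apply: H; have := ltn_ord i; lia.
Qed.

Lemma rec_annihilated r w (F : 'M[int]_(1 + n, r)) (a c : nat) :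
  (forall j, w (j + c).+1 = w (j + c)%N *+ a + w j) ->
  (forall i, (i <= c)%N -> w i *m F = 0) -> forall i, w i *m F = 0.
Proof.
move=> rec wF; elim/ltn_ind => i IH; have [/wF//|ci] := leqP i c.
rewrite -(prednK (leq_ltn_trans (leq0n _) ci)) -[i.-1](@subnK c); last by lia.
rewrite rec mulmxDl -scaler_nat -scalemxAl !IH; try lia.
by rewrite scaler0 addr0.
Qed.

Lemma xcoord_rpt w i : xcoord (rpt w i) = (w i 0 (lshift n 0))%:~R.
Proof. by rewrite xcoordE mxE. Qed.

Lemma ycoord_rpt w i j : ycoord (rpt w i) 0 j = (w i 0 (rshift 1 j))%:~R.
Proof. by rewrite ycoordE mxE. Qed.

Lemma rpt_rec w (a : nat) i j l :
  w i = w j *+ a + w l -> rpt w i = rpt w j *+ a + rpt w l.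
Proof. by move=> h; rewrite /rpt h raddfD raddfMn. Qed.

End Points.

(** * Stages of the construction *)

(* pts 0, ..., pts c is the current window of c.+1 consecutive points, width
   bounds their residues, and the kernel of annih contains B together with the
   previous subspace. *)
Record stage (R : realType) (n : nat) := Stage {
  pts : nat -> 'rV[int]_(1 + n);
  width : R;
  annih : 'M[int]_(1 + n)
}.

Section Stage.
Variables (R : realType) (n c : nat).
Implicit Types (s : stage R n) (e b : R).

Definition top s : 'rV[R]_(1 + n) := rpt R (pts s) c.
Definition center s : 'rV[R]_n := direction (top s).
Definition radius s : R := 8 * width s / xcoord (top s).
(* From N = start s e on, every point of the window has |x| <= e N. *)
Definition start s (e : R) : R := xcoord (top s) / e.

(** [e] is the shortness and [b] the confinement level of the stage. [valid_small] is the hypothesis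
    of [early_bound] with D the width; [valid_start] lets [confined_near] use [annih s] from the
    time [start s e] on; [valid_box] keeps the limit in [0, 1). *)
Record valid e b s : Prop := Valid {
  valid_free : row_free (window c.+1 (rpt R (pts s)) 0);
  valid_pos : 0 < xcoord (rpt R (pts s) 0);
  valid_mono : forall i, (i < c)%N ->
    xcoord (rpt R (pts s) i) <= xcoord (rpt R (pts s) i.+1);
  valid_width : 0 < width s;
  valid_residue : forall i j, (i <= c)%N ->
    `|residue (center s) (rpt R (pts s) i) 0 j| <= width s;
  valid_small :
    6 ^+ n * ((4 ^ n)%:R + 1) ^+ n * width s ^+ n * xcoord (top s) <= e ^+ n.+1;
  valid_annih : forall i, (i <= c)%N -> pts s i *m annih s = 0;
  valid_rank : (1 + n <= \rank (map_mx intr (annih s) : 'M[R]_(1 + n)) + c.+2)%N;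
  valid_start : (2 * form_size R (annih s) * b) ^+ n < start s e;
  valid_box : forall j, 0 <= center s 0 j - radius s /\ center s 0 j + radius s < 1
}.

End Stage.

(** * A single jump out of the current subspace *)

Section Jump.
Variables (R : realType) (n c t m : nat) (w : nat -> 'rV[int]_(1 + n)).
Variables (v : 'rV[int]_(1 + n)) (D : R).
Let x i := xcoord (rpt R w i).
Let J := (t.+1 * c)%N.
Let rho : R := 2 / (4 ^ n)%:R.
Let tau := 2 * D * rho ^+ t.
Let p := direction (rpt R w J).
Let w' := w J *+ m + v.
Let z' : 'rV[R]_(1 + n) := map_mx intr w'.
Let p' := direction z'.

Hypothesis cn : (c + 2 <= n)%N.
Hypothesis wrec : forall j, w (j + c).+1 = w (j + c)%N *+ (4 ^ n) + w j.
Hypothesis wfree : row_free (window c.+1 (rpt R w) 0).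
Hypothesis x0 : 0 < x 0%N.
Hypothesis xmono : forall i, (i < c)%N -> x i <= x i.+1.
Hypothesis D0 : 0 < D.
Hypothesis wD : forall i j, (i <= c)%N ->
  `|residue (direction (rpt R w c)) (rpt R w i) 0 j| <= D.
Hypothesis pbox : forall j, 0 <= p 0 j <= 1.
Hypothesis v01 : forall i, (v 0 i == 0) || (v 0 i == 1).
Hypothesis tau16 : 16 * tau < 1.
Hypothesis mtau : tau^-1 <= m%:R <= tau^-1 + 1.

Lemma jump_n0 : (0 < n)%N.
Proof. by clear -cn; lia. Qed.

Lemma jump_a4 : (4 <= 4 ^ n)%N.
Proof. by rewrite -{1}(expn1 4) leq_exp2l // jump_n0. Qed.

Lemma jump_a0 : (0 < 4 ^ n)%N.
Proof. by rewrite expn_gt0. Qed.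

Lemma jump_xrec j : x (j + c).+1 = x (j + c)%N *+ (4 ^ n) + x j.
Proof.
by rewrite /x (rpt_rec R (wrec j)) !xcoordE !mxE mulmxnE !mxE.
Qed.

Lemma jump_yrec l j : ycoord (rpt R w (j + c).+1) 0 l =
  ycoord (rpt R w (j + c)) 0 l *+ (4 ^ n) + ycoord (rpt R w j) 0 l.
Proof.
by rewrite (rpt_rec R (wrec j)) !ycoordE !mxE mulmxnE !mxE.
Qed.

Lemma jump_x_gt0 i : 0 < x i.
Proof. exact: (rec_gt0 x0 xmono jump_xrec jump_a0). Qed.

Lemma jump_x_le i j : (i <= j)%N -> x i <= x j.
Proof. exact: (rec_le x0 xmono jump_xrec jump_a0). Qed.

Lemma jump_x_ge1 i : 1 <= x i.
Proof. by have := jump_x_gt0 i; rewrite /x xcoord_rpt ltr0z ler1z. Qed.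

Lemma jump_growth k : x (c + k)%N <= ((4 ^ n)%:R + 1) ^+ k * x c.
Proof. exact: (rec_growth x0 xmono jump_xrec jump_a0). Qed.

Lemma jump_cJ : (c <= J)%N.
Proof. by rewrite /J mulSn leq_addr. Qed.

Lemma jump_tau_gt0 : 0 < tau.
Proof.
rewrite /tau !mulr_gt0 // exprn_gt0 // divr_gt0 // ltr0n; exact: jump_a0.
Qed.

Lemma jump_residue s i j : (s * c <= i <= J)%N ->
  `|residue p (rpt R w i) 0 j| <= 2 * D * rho ^+ s.
Proof.
move=> siJ; rewrite residueE directionE.
apply: (orbit_resid jump_a4 x0 xmono jump_xrec (jump_yrec j) _ jump_cJ siJ).
by move=> k kc; have := wD j kc; rewrite residueE directionE.
Qed.

Lemma jump_center : within (direction (rpt R w c)) p (2 * D / x c).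
Proof.
move=> j; rewrite !directionE.
apply: (orbit_center jump_a4 x0 xmono jump_xrec (jump_yrec j) _ jump_cJ).
by move=> k kc; have := wD j kc; rewrite residueE directionE.
Qed.

Lemma jump_rfree j : (0 < c)%N || (j == 0)%N -> row_free (window c.+1 (rpt R w) j).
Proof.
by apply: row_free_window_rec wfree j => i; exact: (rpt_rec R (wrec i)).
Qed.

Lemma jump_bit i : 0 <= ((v 0 i)%:~R : R) <= 1.
Proof. by case/orP: (v01 i) => /eqP ->; rewrite ?lexx ler01. Qed.

Lemma jump_x' : xcoord z' = m%:R * x J + (v 0 (lshift n 0))%:~R.
Proof.
rewrite /z' /w' xcoordE mxE [in LHS]mxE mulmxnE rmorphD rmorphMn /=.
by rewrite mulr_natl /x xcoord_rpt.
Qed.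

(** Since m is about 1 / tau, x(w') is x(w_J) / tau up to a factor 3. The lower bound makes a shift
    of 2 / x(w') cost the old points at most 2 tau; the upper bound reduces tau^n x(w') to tau^(n-1)
    x(w_J). *)
Lemma jump_x'_ge : x J <= tau * xcoord z'.
Proof.
rewrite jump_x'; have t0 := jump_tau_gt0; have xJ := jump_x_gt0 J.
have /andP[v0 _] := jump_bit (lshift n 0); case/andP: mtau => m1 _.
have : 1 <= tau * m%:R by rewrite mulrC -ler_pdivrMr // mul1r.
by move: (_%:~R) v0 (m%:R : R) => b b0 mm; nra.
Qed.

Lemma jump_x'_le : tau * xcoord z' <= 3 * x J.
Proof.
rewrite jump_x'; have t0 := jump_tau_gt0; have xJ := jump_x_ge1 J.
have /andP[v0 v1] := jump_bit (lshift n 0); case/andP: mtau => _ m1.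
have : tau * m%:R <= 1 + tau.
  have -> : 1 + tau = tau * (tau^-1 + 1) by rewrite mulrDr mulfV ?gt_eqF // mulr1.
  by rewrite ler_wpM2l // ltW.
move: (_%:~R) v0 v1 (m%:R : R) => b b0 b1 mm tm.
have h1 : tau * mm * x J <= (1 + tau) * x J by rewrite ler_wpM2r // (le_trans ler01).
have h2 : tau * x J <= 1 * x J.
  by rewrite ler_wpM2r ?(le_trans ler01) //; have := tau16; lra.
have h3 : tau * b <= 1 * 1 by rewrite ler_pM // ?ltW //; have := tau16; lra.
rewrite mulrDr mulrA; lra.
Qed.

Lemma jump_x'_gt0 : 0 < xcoord z'.
Proof.
have := lt_le_trans (jump_x_gt0 J) jump_x'_ge.
by rewrite pmulr_rgt0 // jump_tau_gt0.
Qed.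

(** A positive integer x(w_J) is at least 1. Thus a small tau alone forces x(w') to be large. *)
Lemma jump_x'_inv : tau^-1 <= xcoord z'.
Proof.
rewrite -[leLHS]mulr1 ler_pdivrMl ?jump_tau_gt0 //.
exact: le_trans (jump_x_ge1 J) jump_x'_ge.
Qed.

(** The multiple m w_J has no residue about p, so x(w') (p' - p) is the residue of v, whose entries
    are differences of two numbers in [0, 1]. *)
Lemma jump_direction : within p' p (xcoord z')^-1.
Proof.
move=> j; rewrite /p' directionE.
have x'0 := jump_x'_gt0; have xJ := jump_x_gt0 J.
have yJ : ycoord (rpt R w J) 0 j = x J * p 0 j.
  by rewrite /p directionE mulrC divfK // gt_eqF.
have -> : ycoord z' 0 j = m%:R * (x J * p 0 j) + (v 0 (rshift 1 j))%:~R.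
  rewrite -yJ /z' /w' ycoordE mxE [in LHS]mxE mulmxnE rmorphD rmorphMn /=.
  by rewrite mulr_natl ycoord_rpt.
rewrite -[leRHS]mul1r ler_pdivlMr // -[X in _ * X](gtr0_norm x'0) -normrM.
rewrite mulrBl divfK ?gt_eqF // jump_x'.
rewrite (_ : _ - _ = (v 0 (rshift 1 j))%:~R - p 0 j * (v 0 (lshift n 0))%:~R); last by ring.
have /andP[a0 a1] := jump_bit (rshift 1 j).
have /andP[b0 b1] := jump_bit (lshift n 0).
have /andP[p0 p1] := pbox j.
by rewrite ler_norml; move: (_%:~R) a0 a1 (_%:~R) b0 b1 => a a0 a1 b b0 b1; nra.
Qed.

Lemma jump_near xi : within xi p' (16 * tau / xcoord z') ->
  within xi p (2 / xcoord z').
Proof.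
move=> xp j; have x'0 := jump_x'_gt0.
rewrite -(subrK (p' 0 j) (xi 0 j)) -addrA; apply: le_trans (ler_normD _ _) _.
apply: le_trans (lerD (xp j) (jump_direction j)) _.
rewrite -[X in _ + X]mul1r -mulrDl ler_wpM2r ?invr_ge0 ?(ltW x'0) //.
have := tau16; lra.
Qed.

Lemma jump_residue_near xi s i j : within xi p' (16 * tau / xcoord z') ->
  (s * c <= i <= J)%N -> `|residue xi (rpt R w i) 0 j| <= 2 * D * rho ^+ s + 2 * tau.
Proof.
move=> xp siJ; apply: le_trans (residue_change (jump_residue j siJ) (jump_near xp)) _.
rewrite lerD2l mulrCA ler_pM2l // ler_pdivrMr ?jump_x'_gt0 //.
rewrite gtr0_norm ?jump_x_gt0 //; apply: le_trans jump_x'_ge.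
by apply: jump_x_le; case/andP: siJ.
Qed.

(** With N = P^n: if x_J <= e N, the last window w_(tc), ..., w_J serves, its residues being at most
    3 tau. Otherwise x_i <= e N <= x_(i+1) for some i, and the window ending at w_i serves by
    [early_bound]. *)
Lemma jump_short xi (e e' P : R) :
  within xi p' (16 * tau / xcoord z') -> 0 < e -> 0 < e' -> 0 < P ->
  6 ^+ n * ((4 ^ n)%:R + 1) ^+ n * D ^+ n * x c <= e ^+ n.+1 ->
  (3 * tau) ^+ n * xcoord z' <= e' * e ^+ n ->
  x c / e <= P ^+ n <= xcoord z' / e' -> short_points c.+1 xi P e.
Proof.
move=> xp e0 e'0 P0 De taue /andP[]; rewrite ler_pdivrMr // mulrC => cP PJ.
have [xJ|[i [/andP[ci iJ] xi1 xi2]]] := interval_index jump_cJ cP.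
  apply: (@short_points_window _ _ w _ (t * c)%N).
    by apply: jump_rfree; case: (c); rewrite ?muln0.
  move=> q qJ; have {}qJ : (t * c <= q <= J)%N by rewrite /J mulSn; clear -qJ; lia.
  split=> [|l].
    rewrite gtr0_norm ?jump_x_gt0 //; apply: le_trans xJ; apply: jump_x_le.
    by case/andP: qJ.
  apply: (mul_le_of_exp jump_n0 _ (ltW P0) e0 e'0 PJ) => //.
  apply: le_trans taue; rewrite ler_wpM2r ?(ltW jump_x'_gt0) //.
  have h := jump_residue_near l xp qJ.
  rewrite lerXn2r ?nnegrE ?(mulr_ge0 (ler0n _ 3) (ltW jump_tau_gt0)) //.
  by apply: le_trans h _; rewrite -/tau; lra.
(* For c = 0 also J = 0, and the range of i is empty. *)
have c0 : (0 < c)%N.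
  by move: ci iJ; rewrite /J; case: (c) => //; rewrite muln0.
apply: (@short_points_window _ _ w _ (i - c)%N); first by apply: jump_rfree; rewrite c0.
move=> q qi; split=> [|l].
  rewrite gtr0_norm ?jump_x_gt0 //; apply: le_trans xi1; apply: jump_x_le.
  by clear -qi ci; lia.
have qJ : (q < J)%N by clear -qi ci iJ; move: (J) iJ; lia.
apply: (early_bound cn qJ D0 (ltW P0) e0 (jump_x_gt0 c) jump_growth De) => //.
  by apply: jump_residue_near => //; rewrite leq_divM ltnW.
rewrite ler_pdivlMr // mulrC; apply: le_trans xi2 _; apply: jump_x_le.
by clear -qi ci; lia.
Qed.
End Jump.

(** * From one stage to the next *)

Lemma rec_submx (R : fieldType) m c (w : nat -> 'rV[R]_m) (a : nat) :
  (forall j, w (j + c).+1 = w (j + c)%N *+ a + w j) ->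
  forall i, (w i <= window c.+1 w 0)%MS.
Proof.
move=> rec; elim/ltn_ind => i IH; have [ic|ci] := leqP i c.
  by apply: sub_window; rewrite add0n ltnS ic.
rewrite -(prednK (leq_ltn_trans (leq0n _) ci)) -[i.-1](@subnK c); last by lia.
rewrite rec addmx_sub ?IH //; try lia.
by rewrite -scaler_nat scalemx_sub // IH //; lia.
Qed.

(** If x phi vanishes, v phi remains; otherwise x phi is a nonzero integer, and m times it outweighs
    v phi. *)
Lemma jump_form_neq0 (R : realType) n (x v : 'rV[int]_n) (phi : 'cV[int]_n) (m : nat) :
  (forall i, (v 0 i == 0) || (v 0 i == 1)) -> v *m phi != 0 ->
  form_size R phi < m%:R -> (x *+ m + v) *m phi != 0.
Proof.
move=> v01 vphi phim; rewrite mulmxDl -scaler_nat -scalemxAl.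
have [->|x0] := eqVneq (x *m phi) 0; first by rewrite scaler0 add0r.
apply/negP => /eqP /matrixP /(_ 0 0); rewrite 2![in LHS]mxE [RHS]mxE => E.
have : `|((v *m phi) 0 0)%:~R| < m%:R :> R.
  apply: le_lt_trans phim.
  have := @normr_mulmx_le R _ _ (map_mx intr v) (map_mx intr phi) 1 0.
  rewrite -map_mxM mxE mulr1 => H; apply: le_trans (H _) _.
    by move=> i; rewrite mxE; case/orP: (v01 i) => /eqP ->; rewrite ?normr0 ?normr1.
  by apply: ler_sum => i _; apply: ler_sum => j _; rewrite mxE.
have -> : (v *m phi) 0 0 = - (m%:R * (x *m phi) 0 0) by apply/eqP; rewrite -addr_eq0 addrC E.
rewrite rmorphN normrN rmorphM normrM rmorph_nat normr_nat.
rewrite gtr_pMr; last by apply: le_lt_trans phim; rewrite form_size_ge0.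
rewrite -intr_norm ltrz1 -[1]add0r ltzD1 normr_le0 => /eqP x1.
by case/eqP: x0; apply/matrixP => i j; rewrite !ord1 x1 mxE.
Qed.

Lemma exists_small_factor (R : realFieldType) (s : seq R) :
  all (fun k => 0 <= k) s ->
  exists th, 0 < th /\ forall k q, k \in s -> q <= th -> k * q < 1.
Proof.
move=> /allP s0.
have S0 : 0 <= \sum_(k <- s) k by rewrite big_seq sumr_ge0.
have S1 : 0 < 1 + \sum_(k <- s) k by rewrite ltr_wpDr.
exists (1 + \sum_(k <- s) k)^-1; split=> [|k q ks qS]; first by rewrite invr_gt0.
apply: le_lt_trans (ler_wpM2l (s0 _ ks) qS) _; rewrite ltr_pdivrMr // mul1r.
rewrite ltr_pwDl // (big_rem k ks) /= lerDl big_seq sumr_ge0 // => i.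
by move/mem_rem; apply: s0.
Qed.

(** One step of the induction: the window is prolonged by the recurrence up to w_J, then w' is
    adjoined. The vector v and the matrix F', which kills B and v, depend only on the old stage; t
    is chosen last, so tau can be small in terms of everything else. *)
Lemma stage_step (R : realType) (n c : nat) (s : stage R n) (e e' b b' B : R)
    (phi : 'cV[int]_(1 + n)) :
  (c + 2 <= n)%N -> 0 < e -> 0 < e' -> 0 <= b -> 0 <= b' -> phi != 0 ->
  valid c e b s ->
  exists s' : stage R n, [/\ valid c e' b' s', B <= start c s' e' &
    forall xi, within xi (center c s') (radius c s') ->
      [/\ within xi (center c s) (radius c s),
          xypoint 1 xi *m map_mx intr phi != 0 &
          forall P, 0 < P -> start c s e <= P ^+ n <= start c s' e' ->
            short_points c.+1 xi P e /\ confined c.+2 xi P b]].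
Proof.
move=> cn e0 e'0 b0 b'0 phi0 [sfree spos smono sD sres ssmall sann srank sstart sbox].
have [w [wu wrec]] := recurrence_exists (4 ^ n) c (pts s).
have ru i : (i <= c)%N -> rpt R (pts s) i = rpt R w i by move=> ic; rewrite /rpt wu.
rewrite /center /radius /start /top ru // in sres ssmall sstart sbox *.
have {sfree} wfree : row_free (window c.+1 (rpt R w) 0).
  rewrite (_ : window _ _ _ = window c.+1 (rpt R (pts s)) 0) //.
  by apply/row_matrixP => i; rewrite !row_window !add0n ru // -ltnS.
have {spos} x0 : 0 < xcoord (rpt R w 0) by rewrite -ru.
have {smono} xmono i : (i < c)%N -> xcoord (rpt R w i) <= xcoord (rpt R w i.+1).
  by move=> ic; rewrite -!ru // ?(ltnW ic) //; apply: smono.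
have {sres} wD i j : (i <= c)%N ->
    `|residue (direction (rpt R w c)) (rpt R w i) 0 j| <= width s.
  by move=> ic; rewrite -[rpt R w i]ru //; apply: sres.
have {sann wu} wF := rec_annihilated wrec (fun i ic =>
  etrans (congr1 (mulmx^~ (annih s)) (wu i ic)) (sann i ic)).
set D := width s in sD ssmall sbox wD *; set F := annih s in srank sstart wF *.
set r := rpt R w in ru wfree x0 xmono wD ssmall sstart sbox *.
have n0 : (0 < n)%N by clear -cn; lia.
have [v [v01 vw vphi]] := int_vector_avoiding (window c.+1 r 0)
  (ltac:(clear -cn; lia) : (c.+1 < 1 + n)%N) phi0.
have [F' [WF' rF']] := int_annihilator R (col_mx (window c.+1 w 0) v).
have {WF'} [w0F' vF'] : window c.+1 w 0 *m F' = 0 /\ v *m F' = 0.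
  by move/eqP: WF'; rewrite mul_col_mx col_mx_eq0 => /andP[/eqP ? /eqP ?].
rewrite (addn1 c.+1) in rF'.
have wF' := rec_annihilated (F := F') wrec.
have {}wF' i : w i *m F' = 0.
  apply: wF' => k kc; have := congr1 (row (Ordinal (kc : k < c.+1)%N)) w0F'.
  by rewrite row_mul row_window row0.
have xg := jump_growth wrec x0 xmono.
pose f := form_size R F; pose f' := form_size R F'; pose g := form_size R phi.
have f0 : 0 <= f := form_size_ge0 R F.
have f'0 : 0 <= f' := form_size_ge0 R F'.
have g0 : 0 <= g := form_size_ge0 R phi.
(* Up to time S the points are confined by F, later by F'. *)
pose S := (2 * f' * b) ^+ n + 1.
have S0 : 0 <= S by rewrite addr_ge0 ?exprn_ge0 ?mulr_ge0.
pose K : R := 6 ^+ n * ((4 ^ n)%:R + 1) ^+ n.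
have K0 : 0 <= K by rewrite mulr_ge0 ?exprn_ge0 ?addr_ge0.
(* [c2] serves [valid_small] of the new stage, [c3] the last window in [jump_short], [c5] and [c6]
   confinement by F' and by F, [c7] the new [valid_start], and [c8] below the bound B. The first two
   are multiplied by tau^(n-1) x(w_J), the others by tau. *)
pose c2 := 3 * 2 ^+ n * K / e' ^+ n.+1.
pose c3 := 3 * 3 ^+ n / (e' * e ^+ n).
pose c5 := 32 * (f' * b) / e'.
pose c6 := 4 * (f * b * S).
pose c7 := (2 * f' * b') ^+ n * e'.
have en0 : 0 < e ^+ n by rewrite exprn_gt0.
have e'n0 : 0 < e' ^+ n.+1 by rewrite exprn_gt0.
have c20 : 0 <= c2 by rewrite divr_ge0 ?(ltW e'n0) // !mulr_ge0 ?exprn_ge0.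
have c30 : 0 <= c3.
  by rewrite divr_ge0 // mulr_ge0 ?exprn_ge0 // ltW.
have c50 : 0 <= c5 by rewrite divr_ge0 ?(ltW e'0) // !mulr_ge0.
have c60 : 0 <= c6 by rewrite !mulr_ge0.
have c70 : 0 <= c7 by rewrite mulr_ge0 ?(ltW e'0) // exprn_ge0 // !mulr_ge0.
pose c8 := `|B| * e'.
have c80 : 0 <= c8 by rewrite mulr_ge0 // ltW.
(* All the conditions on tau follow from the smallness of its product with these
   constants, which do not depend on t. *)
have [|th [th0 small]] :=
    @exists_small_factor R [:: 16; c2; c3; 16 * g; c5; c6; c7; c8].
  by rewrite /= ler0n c20 c30 mulr_ge0 // c50 c60 c70 c80.
have [t [tau_le tau_x]] := exists_small_scale cn sD th0 (jump_x_gt0 wrec x0 xmono c) xg.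
set tau := 2 * D * _ ^+ t in tau_le tau_x.
have tau0 : 0 < tau := jump_tau_gt0 n t sD.
pose m := (Num.truncn tau^-1).+1.
have mtau : tau^-1 <= m%:R <= tau^-1 + 1.
  rewrite ltW ?truncnS_gt //= -natr1 lerD2r truncn_le // invr_ge0 ltW //.
have tau16 : 16 * tau < 1 by apply: small tau_le; rewrite !inE eqxx ?orbT.
have x_gt0 := jump_x_gt0 wrec x0 xmono.
have pc := jump_center t cn wrec x0 xmono wD.
pose J := (t.+1 * c)%N.
pose p := direction (r J).
have pbox j : 0 <= p 0 j <= 1.
  have [h1 h2] := sbox j; have := pc j; rewrite ler_norml -/J -/r -/p => /andP[h3 h4].
  have := divr_gt0 sD (x_gt0 c); move: h1 h2 h3 h4; rewrite -/r.
  by rewrite -!mulrA; move: (D / _) => u; lra.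
pose w' := w J *+ m + v.
pose z' : 'rV[R]_(1 + n) := map_mx intr w'.
pose x' := xcoord z'.
have x'_gt0 : 0 < x' := jump_x'_gt0 wrec x0 xmono sD v01 mtau.
have x'_ge : xcoord (r J) <= tau * x' := jump_x'_ge wrec x0 xmono sD v01 mtau.
have x'_le : tau * x' <= 3 * xcoord (r J) :=
  jump_x'_le wrec x0 xmono sD v01 tau16 mtau.
have x'_inv : tau^-1 <= x' := jump_x'_inv wrec x0 xmono sD v01 mtau.
have tau_x' : tau ^+ n * x' <= 3 * (tau ^+ n.-1 * xcoord (r J)).
  by rewrite -{1}(prednK n0) exprSr -mulrA [leRHS]mulrCA ler_wpM2l ?exprn_ge0 ?(ltW tau0).
have small' : K * (2 * tau) ^+ n * x' <= e' ^+ n.+1.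
  have : c2 * (tau ^+ n.-1 * xcoord (r J)) < 1.
    by apply: small tau_x; rewrite !inE eqxx ?orbT.
  rewrite /c2 mulrAC ltr_pdivrMr // mul1r => /ltW; apply: le_trans.
  rewrite exprMn (_ : _ * x' = K * 2 ^+ n * (tau ^+ n * x')); last by ring.
  apply: le_trans (ler_wpM2l _ tau_x') _; first by rewrite mulr_ge0 ?exprn_ge0.
  by rewrite le_eqVlt; apply/orP; left; apply/eqP; ring.
have late : (3 * tau) ^+ n * x' <= e' * e ^+ n.
  have : c3 * (tau ^+ n.-1 * xcoord (r J)) < 1.
    by apply: small tau_x; rewrite !inE eqxx ?orbT.
  rewrite /c3 mulrAC ltr_pdivrMr ?mulr_gt0 // mul1r => /ltW; apply: le_trans.
  rewrite exprMn -mulrA; apply: le_trans (ler_wpM2l _ tau_x') _; first by rewrite exprn_ge0.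
  by rewrite le_eqVlt; apply/orP; left; apply/eqP; ring.
have tau_g : 16 * g * tau < 1 by apply: small tau_le; rewrite !inE eqxx ?orbT.
have tau_5 : c5 * tau < 1 by apply: small tau_le; rewrite !inE eqxx ?orbT.
have tau_6 : c6 * tau < 1 by apply: small tau_le; rewrite !inE eqxx ?orbT.
have tau_7 : c7 * tau < 1 by apply: small tau_le; rewrite !inE eqxx ?orbT.
have tau_8 : c8 * tau < 1 by apply: small tau_le; rewrite !inE eqxx ?orbT.
have div_gt k : k * e' * tau < 1 -> k < x' / e'.
  move=> h; rewrite ltr_pdivlMr //; apply: lt_le_trans x'_inv.
  by rewrite -[ltRHS]mul1r ltr_pdivlMr.
pose u i := if (i < c)%N then w (t * c + i).+1 else w'.
(* Width 2 tau: residues about p are at most tau, and passing from p to p' adds x_i / x(w') <=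
   tau. *)
pose s' := Stage u (2 * tau) F'.
have uE i : (i < c)%N -> rpt R u i = r (t * c + i).+1 by rewrite /rpt /u => ->.
have uc : rpt R u c = z' by rewrite /rpt /u ltnn.
have rad : 8 * (2 * tau) / x' = 16 * tau / x' by congr (_ / _); ring.
have inv_x' : x'^-1 <= tau.
  by rewrite -[leLHS]mul1r ler_pdivrMr //; apply: le_trans x'_ge; apply: jump_x_ge1.
have tauD : tau <= 2 * D.
  rewrite ler_piMr ?mulr_ge0 ?(ltW sD) // exprn_ile1 // ?divr_ge0 //.
  rewrite ler_pdivrMr ?ltr0n ?expn_gt0 // mul1r ler_nat.
  exact: leq_trans (jump_a4 cn).
(* The factor 8 in [radius] is ample: p is within 2 D / x_c of the old center, and since x_c <= 2 D
   x(w'), the distance from p to p' together with the new radius is at most 4 D / x_c. *)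
have nest j : `|direction z' 0 j - direction (r c) 0 j| + 16 * tau / x' <=
    8 * D / xcoord (r c).
  have h1 := jump_direction wrec x0 xmono sD pbox v01 mtau j.
  have h2 := pc j.
  have h3 : (1 + 16 * tau) / x' <= 4 * D / xcoord (r c).
    rewrite ler_pdivrMr // mulrAC ler_pdivlMr //.
    have h4 : xcoord (r c) <= 2 * D * x'.
      apply: le_trans (_ : tau * x' <= _); last by rewrite ler_wpM2r // ltW.
      apply: le_trans x'_ge; apply: jump_x_le => //.
      by rewrite /J mulSn leq_addr.
    have h5 : (1 + 16 * tau) * xcoord (r c) <= 2 * xcoord (r c).
      by rewrite ler_wpM2r ?(ltW (x_gt0 _)) //; lra.
    lra.
  have h6 : `|direction z' 0 j - direction (r c) 0 j| <= x'^-1 + 2 * D / xcoord (r c).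
    rewrite -(subrK (p 0 j) (direction z' 0 j)) -addrA.
    by apply: le_trans (ler_normD _ _) _; apply: lerD => //; rewrite distrC.
  apply: le_trans (lerD h6 (lexx _)) _.
  rewrite mulrDl mul1r in h3; have := divr_gt0 sD (x_gt0 c).
  rewrite -!mulrA in h3 *; move: (D / _) h3 => q h3.
  clear -h3; move: (tau / x') (x'^-1) h3 => y z; lra.
exists s'.
have topE : top c s' = z' by rewrite /top uc.
rewrite /= uc rad.
split.
- split=> /=.
  + apply: (row_free_window_jump (w := r) (j := t * c) (a := m) (v := map_mx intr v)).
    * by apply: jump_rfree => //; case: (c); rewrite ?muln0.
    * apply: contra vw => h; apply: submx_trans h _; apply/row_subP => i.
      by rewrite row_window; apply: rec_submx => j; apply: rpt_rec (wrec j).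
    * exact: uE.
    * rewrite uc /z' /w' /J mulSn (addnC c) raddfD raddfMn //.
  + have [c0|c0] := posnP c; last by rewrite uE.
    by rewrite (_ : rpt R u 0 = z') // -uc; congr (rpt _ _ _).
  + move=> i ic; rewrite uE //; have [ic'|ci] := ltnP i.+1 c.
      by rewrite uE //; apply: jump_x_le => //; rewrite addnS leqnSn.
    have -> : i.+1 = c by apply/eqP; rewrite eqn_leq ic ci.
    rewrite uc; apply: le_trans (_ : xcoord (r J) <= _).
      by apply: jump_x_le => //; rewrite /J mulSn (addnC c) -addnS leq_add2l.
    apply: le_trans x'_ge _; rewrite ler_piMl ?(ltW x'_gt0) //; lra.
  + by rewrite mulr_gt0.
  + move=> i j; rewrite /center topE leq_eqVlt => /predU1P[->|ic].
      rewrite uc residueE directionE mulrC divfK ?subrr ?normr0 ?gt_eqF //.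
      by rewrite mulr_ge0 // ltW.
    rewrite uE //.
    have tJ : (t * c <= (t * c + i).+1 <= J)%N.
      by rewrite /J mulSn (addnC c) -addnS leq_addr leq_add2l.
    have h1 := jump_residue cn wrec x0 xmono wD j tJ.
    have h2 := jump_direction wrec x0 xmono sD pbox v01 mtau.
    apply: le_trans (residue_change h1 h2) _.
    have : xcoord (r (t * c + i).+1) / x' <= tau.
      rewrite ler_pdivrMr //; apply: le_trans x'_ge; apply: jump_x_le => //.
      by case/andP: tJ.
    by rewrite (gtr0_norm (x_gt0 _)) -/tau -/x' -/r; lra.
  + by rewrite topE.
  + move=> i ic; rewrite /u; case: ifP => _ //.
    by rewrite mulmxDl -scaler_nat -scalemxAl wF' vF' scaler0 addr0.
  + exact: rF'.
  + by rewrite /start topE; apply: div_gt.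
  + move=> j; rewrite /center /radius topE rad.
    have [h1 h2] := sbox j; have := nest j.
    have := ler_norm (direction z' 0 j - direction (r c) 0 j).
    have := ler_norm (direction (r c) 0 j - direction z' 0 j).
    rewrite distrC -/x' -/r; lra.
- apply: le_trans (ler_norm B) _; exact/ltW/div_gt.
move=> xi xin.
have xip := jump_near wrec x0 xmono sD pbox v01 tau16 mtau xin.
split.
- move=> j; apply: le_trans (nest j).
  rewrite -(subrK (direction z' 0 j) (xi 0 j)) -addrA addrC.
  by apply: le_trans (ler_normD _ _) _; rewrite lerD2l.
(* If phi vanished at (1, xi), the nonzero integer w' phi would be phi of the residue of w' about
   xi, of size at most 16 g tau < 1. *)
- have : w' *m phi != 0.
    apply: (@jump_form_neq0 R) => //; apply: le_lt_trans (_ : tau^-1 < _).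
      by rewrite -[leRHS]mul1r ler_pdivlMr // -/g; nra.
    by rewrite /m truncnS_gt.
  apply: contra => /eqP xi0; apply/eqP/matrixP => i j; rewrite !ord1 [RHS]mxE.
  have : `|((w' *m phi) 0 0)%:~R| < 1 :> R.
    have -> : ((w' *m phi) 0 0)%:~R = (xypoint 0 (residue xi z') *m map_mx intr phi) 0 0 :> R.
      rewrite -sub_xypoint mulmxBl -scalemxAl xi0 scaler0 subr0 -map_mxM.
      by rewrite [RHS]mxE.
    apply: le_lt_trans (intr_mulmx_le _ _ (normr_xypoint_le (b := 16 * tau) _ _)) _.
    + by rewrite normr0 mulr_ge0 // ltW.
    + move=> k; have := xin k; rewrite ler_pdivlMr // -[X in _ * X](gtr0_norm x'_gt0).
      rewrite -normrM residueE directionE mulrBl divfK ?gt_eqF // distrC mulrC.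
      by rewrite -/x' [X in _ - X]mulrC distrC.
    + by rewrite -/g mulrCA mulrA.
  by rewrite -intr_norm ltrz1 -[1]add0r ltzD1 normr_le0 => /eqP.
move=> P P0 tP; split.
  exact: (jump_short cn wrec wfree x0 xmono sD wD pbox v01 tau16 mtau xin e0 e'0 P0 ssmall late tP).
case/andP: tP => tP1 tP2.
have exp_lt k : 0 <= k -> k ^+ n < P ^+ n -> k < P.
  by move=> k0; rewrite ltr_pXn2r // nnegrE // ltW.
(* F' may be so large that it confines only after time S. Until then the old F does: S is fixed
   before tau, and xi is within 2 / x(w') <= 2 tau of p. *)
have [PS|SP] := leP (P ^+ n) S.
  apply: (@confined_near _ _ _ xi (w J) F P b (2 / x')) => //.
  - by rewrite gt_eqF // x_gt0.
  - by rewrite divr_ge0 // ltW.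
  - apply: exp_lt; first by rewrite !mulr_ge0.
    exact: lt_le_trans sstart tP1.
  - apply: le_lt_trans tau_6; rewrite /c6.
    apply: le_trans (_ : 2 * (f * b * S * (2 * tau)) <= _); last by lra.
    rewrite ler_pM2l // ler_pM ?mulr_ge0 ?exprn_ge0 ?invr_ge0 ?(ltW P0) ?(ltW x'_gt0) //.
      by rewrite ler_wpM2l // mulr_ge0.
    by rewrite ler_pM2l.
(* Now 2 f' b < P, and N <= x(w') / e' cancels the x(w') in the radius 16 tau / x(w'). *)
apply: (@confined_near _ _ _ xi w' F' P b (16 * tau / x')) => //.
- by rewrite gt_eqF.
- by rewrite mulmxDl -scaler_nat -scalemxAl wF' vF' scaler0 addr0.
- by rewrite divr_ge0 ?(ltW x'_gt0) // mulr_ge0 // ltW.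
- apply: exp_lt; first by rewrite !mulr_ge0.
  by apply: lt_trans SP; rewrite /S ltrDl.
- apply: le_lt_trans tau_5; rewrite /c5.
  apply: le_trans (_ : 2 * (f' * b * (x' / e') * (16 * tau / x')) <= _).
    rewrite ler_pM2l // ler_wpM2r //.
      by rewrite divr_ge0 ?(ltW x'_gt0) // mulr_ge0 // ltW.
    by rewrite ler_wpM2l // mulr_ge0.
  rewrite le_eqVlt; apply/orP; left; apply/eqP; field.
  by rewrite !gt_eqF.
Qed.

(** * Successive minima in terms of short points and confinement *)

Lemma enormZ (R : realType) n (a : R) (y : 'rV[R]_n) : enorm (a *: y) = `|a| * enorm y.
Proof.
rewrite /enorm; under eq_bigr do rewrite mxE exprMn.
by rewrite -mulr_sumr sqrtrM ?sqr_ge0 // sqrtr_sqr.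
Qed.

Lemma normr_le_enorm (R : realType) n (y : 'rV[R]_n) j : `|y 0 j| <= enorm y.
Proof.
rewrite -sqrtr_sqr ler_wsqrtr // (bigD1 j) //= lerDl sumr_ge0 // => i _.
exact: sqr_ge0.
Qed.

(** The crude constant n in place of its square root suffices, as only limits of the minima
    matter. *)
Lemma enorm_le (R : realType) n (y : 'rV[R]_n) (b : R) :
  (forall j, `|y 0 j| <= b) -> 0 <= b -> enorm y <= n%:R * b.
Proof.
move=> yb b0; rewrite -(ger0_norm (mulr_ge0 (ler0n R n) b0)) -sqrtr_sqr.
rewrite ler_wsqrtr //; apply: le_trans (_ : \sum_(j < n) b ^+ 2 <= _).
  by apply: ler_sum => j _; rewrite -real_normK ?num_real // lerXn2r ?nnegrE.
rewrite sumr_const card_ord exprMn -[leLHS]mulr_natl.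
rewrite ler_wpM2r ?sqr_ge0 // -natrX ler_nat; case: (n) => // m.
by rewrite expnS leq_pmulr.
Qed.

Section Minima.
Variables (R : realType) (n : nat).
Implicit Types (xi : 'rV[R]_n) (z : 'rV[R]_(1 + n)) (N t : R).

Lemma xcoordZ t z : xcoord (t *: z) = t * xcoord z.
Proof. by rewrite !xcoordE mxE. Qed.

Lemma ycoordZ t z : ycoord (t *: z) = t *: ycoord z.
Proof. by apply/rowP => j; rewrite [RHS]mxE !ycoordE mxE. Qed.

Lemma scaled_cylinder t z : 0 < t ->
  [set t *: w | w in @unit_cylinder R n] z <->
  `|xcoord z| <= t /\ enorm (ycoord z) <= t.
Proof.
move=> t0; split=> [[w]|[zx zy]].
  rewrite /unit_cylinder /= ge_max => /andP[wx wy] <-.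
  by rewrite xcoordZ ycoordZ normrM enormZ gtr0_norm // !ler_piMr // ltW.
exists (t^-1 *: z); last by rewrite scalerA divff ?gt_eqF // scale1r.
rewrite /unit_cylinder /= xcoordZ ycoordZ normrM enormZ gtr0_norm ?invr_gt0 //.
by rewrite ge_max !ler_pdivrMl // mulr1 zx zy.
Qed.

(** The map acts on rows from the right. It is block triangular and, for N > 0, invertible, so
    independence of lattice points can be tested on their integer preimages. *)
Definition approx_mx xi N : 'M[R]_(1 + n) :=
  block_mx (N^-1)%:M (N `^ n%:R^-1 *: xi) 0 (- (N `^ n%:R^-1))%:M.

Lemma approx_mxE xi N z : approx_map (xypoint 1 xi) N z = z *m approx_mx xi N.
Proof.
rewrite /approx_map /approx_mx ycoord_xypoint -[z in RHS]xypoint_coords /xypoint.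
rewrite mul_row_block mulmx0 addr0; congr (row_mx _ _).
  by rewrite mul_mx_scalar; apply/rowP => i; rewrite !mxE.
apply/rowP => j; rewrite mul_mx_scalar !mxE big_ord1 !mxE; ring.
Qed.

Lemma approx_mx_unit xi N : 0 < N -> approx_mx xi N \in unitmx.
Proof.
move=> N0; rewrite unitmxE /approx_mx det_ublock !det_scalar unitfE mulf_neq0 //.
  by rewrite expr1 invr_eq0 gt_eqF.
by rewrite expf_neq0 // oppr_eq0 gt_eqF // powR_gt0.
Qed.

Lemma mxrank_approx l (Q : 'M[R]_(l, 1 + n)) xi N : 0 < N ->
  \rank (Q *m approx_mx xi N) = \rank Q.
Proof. by move=> N0; rewrite mxrankMfree // row_free_unit approx_mx_unit. Qed.

Lemma xcoord_approx xi N z : xcoord (z *m approx_mx xi N) = N^-1 * xcoord z.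
Proof. by rewrite -approx_mxE /approx_map xcoord_xypoint. Qed.

Lemma ycoord_approx xi N z :
  ycoord (z *m approx_mx xi N) = - (N `^ n%:R^-1) *: residue xi z.
Proof.
rewrite -approx_mxE /approx_map ycoord_xypoint; apply/rowP => j.
by rewrite [LHS]mxE ycoord_xypoint [RHS]mxE residueE; ring.
Qed.

Lemma mu_ge0 l xi N : 0 <= mu l (xypoint 1 xi) N.
Proof.
rewrite /mu /succ_min; set S := [set t | _].
have [->|/set0P S0] := eqVneq S set0; first by rewrite inf0.
by apply: lb_le_inf => // t [/ltW].
Qed.

Lemma powR_root N : (0 < n)%N -> 0 < N -> (N `^ n%:R^-1) ^+ n = N.
Proof.
move=> n0 N0; rewrite -powR_mulrn ?powR_ge0 // -powRrM mulVf ?powRr1 ?ltW //.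
by rewrite pnatr_eq0 -lt0n.
Qed.

Lemma mu_le_short l xi N e : (0 < n)%N -> 0 < N -> 0 < e ->
  short_points l xi (N `^ n%:R^-1) e -> mu l (xypoint 1 xi) N <= n%:R * e.
Proof.
move=> n0 N0 e0 [Q [Qf QP]]; have n1 : 1 <= n%:R :> R by rewrite ler1n.
rewrite /mu /succ_min; apply: ge_inf; first by exists 0 => t [/ltW].
split; first by rewrite mulr_gt0 ?ltr0n.
exists (map_mx intr Q *m approx_mx xi N); split.
  by rewrite /row_free mxrank_approx.
move=> i; rewrite row_mul; split.
  exists (map_mx intr (row i Q)); first by exists (row i Q).
  by rewrite approx_mxE map_row.
have [Qx Qy] := QP i; rewrite scaled_cylinder ?mulr_gt0 ?ltr0n //; split.
  rewrite xcoord_approx normrM gtr0_norm ?invr_gt0 // ler_pdivrMl //.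
  apply: le_trans Qx _; rewrite powR_root // mulrC ler_pM2l //.
  by rewrite ler_peMl // ltW.
rewrite ycoord_approx; apply: enorm_le; last exact: ltW.
move=> j; have := Qy j; rewrite [in X in _ -> X]mxE normrM normrN mulrC.
by rewrite (ger0_norm (powR_ge0 _ _)).
Qed.

(** An admissible t < b would give l independent integer points in the kernel of F, whose dimension
    is at most r < l. *)
Lemma mu_ge_confined l r xi N b : (0 < n)%N -> 0 < N -> (r < l <= 1 + n)%N ->
  confined r xi (N `^ n%:R^-1) b -> b <= mu l (xypoint 1 xi) N.
Proof.
move=> n0 N0 /andP[rl ln] [F [rF FP]].
rewrite /mu /succ_min; apply: lb_le_inf.
  (* As [inf set0] is 0, some admissible t must be exhibited first: the images of l standard basis
     vectors with t large. *)
  pose Q : 'M[R]_(l, 1 + n) := pid_mx l.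
  pose M := Q *m approx_mx xi N.
  pose t := 1 + \sum_i (`|xcoord (row i M)| + enorm (ycoord (row i M))).
  have t_ge i : `|xcoord (row i M)| + enorm (ycoord (row i M)) <= t.
    rewrite /t (bigD1 i) //= addrA addrAC lerDr addr_ge0 // sumr_ge0 // => j _.
    by rewrite addr_ge0 // sqrtr_ge0.
  have t0 : 0 < t.
    rewrite ltr_pwDl // sumr_ge0 // => j _.
    by rewrite addr_ge0 // sqrtr_ge0.
  exists t; split=> //; exists M; split.
    by rewrite /row_free mxrank_approx // rank_pid_mx.
  move=> i; split.
    exists (row i Q); last by rewrite approx_mxE /M row_mul.
    by exists (row i (pid_mx l)) => //; rewrite map_row map_pid_mx.
  rewrite scaled_cylinder //; split.
    by apply: le_trans (t_ge i); rewrite lerDl sqrtr_ge0.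
  by apply: le_trans (t_ge i); rewrite lerDr.
move=> t [t0 [M [Mf MP]]]; rewrite leNgt; apply/negP => tb.
have /choice[q qP] : forall i, exists q : 'rV[int]_(1 + n),
    map_mx intr q *m approx_mx xi N = row i M.
  by move=> i; have [[z [q _ <-] <-] _] := MP i; exists q; rewrite approx_mxE.
pose Q : 'M[int]_(l, 1 + n) := \matrix_i q i.
have QM : map_mx intr Q *m approx_mx xi N = M.
  by apply/row_matrixP => i; rewrite row_mul -qP -map_row rowK.
have QF : Q *m F = 0.
  apply/row_matrixP => i; rewrite row_mul rowK row0; apply: FP => [|j].
    have [_] := MP i; rewrite scaled_cylinder // -qP xcoord_approx => -[+ _].
    rewrite normrM gtr0_norm ?invr_gt0 // ler_pdivrMl // powR_root // mulrC => h.
    by apply: le_trans h _; rewrite ler_wpM2r // ltW.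
  have [_] := MP i; rewrite scaled_cylinder // -qP ycoord_approx => -[_ +].
  move/(le_trans (normr_le_enorm _ j)); rewrite mxE normrM normrN mulrC.
  by rewrite (ger0_norm (powR_ge0 _ _)) => /le_trans; apply; exact: ltW.
have : (map_mx intr Q : 'M[R]_(l, 1 + n)) *m map_mx intr F = 0.
  by rewrite -map_mxM QF map_mx0.
move/mulmx0_rank_max; rewrite -(mxrank_approx _ xi N0) QM.
move: Mf; rewrite /row_free => /eqP ->; move: rF; clear -rl; lia.
Qed.

End Minima.

(** * The initial stage and the limit point *)

(** The first e may be large, which gives [valid_small] at once, and b = 0 trivializes
    [valid_start]. *)
Lemma initial_stage (R : realType) (n c : nat) : (c + 2 <= n)%N ->
  exists (e : R) (s : stage R n), 0 < e /\ valid c e 0 s.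
Proof.
move=> cn.
have n0 : (0 < n)%N by clear -cn; lia.
(* All directions are within 1/64 of (1/2, ..., 1/2) in each coordinate, with residues at most 1;
   the radius is 8 / 64 = 1/8, so the box lies in [0, 1). *)
pose u i : 'rV[int]_(1 + n) :=
  \row_j (if j == 0 :> nat then 64 else 32 + (j == i.+1 :> nat)%:Z).
have xu i : xcoord (rpt R u i) = 64 by rewrite xcoord_rpt mxE.
have yu i j : ycoord (rpt R u i) 0 j = 32 + (j == i :> nat)%:R.
  by rewrite ycoord_rpt mxE /= eqSS rmorphD /= natz.
have cu i j : direction (rpt R u i) 0 j = (32 + (j == i :> nat)%:R) / 64.
  by rewrite directionE xu yu.
have [F [WF rF]] := int_annihilator R (window c.+1 u 0).
pose K : R := 6 ^+ n * ((4 ^ n)%:R + 1) ^+ n.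
have K0 : 0 <= K by rewrite mulr_ge0 ?exprn_ge0 ?addr_ge0.
pose e : R := K * 64 + 1.
have e1 : 1 <= e by rewrite lerDr mulr_ge0.
exists e, (Stage u 1 F); split; first exact: lt_le_trans e1.
have b01 (b : bool) : 0 <= (b%:R : R) <= 1 by case: b; rewrite ?lexx ler01.
split; rewrite /center /radius /start /top ?xu /=.
- rewrite -kermx_eq0; apply/rowV0P => v /sub_kermxP vW.
  have colE j : \sum_i v 0 i * rpt R u i 0 j = 0.
    have /matrixP /(_ 0 j) := vW; rewrite [LHS]mxE [RHS]mxE => E.
    by rewrite -[RHS]E; apply: eq_bigr => i _; rewrite [window _ _ _ _ _]mxE add0n.
  have v1 : \sum_i v 0 i = 0.
    apply/eqP; have := colE (lshift n 0).
    under eq_bigr do rewrite -xcoordE xu.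
    by rewrite -mulr_suml => /eqP; rewrite mulf_eq0 pnatr_eq0 orbF.
  apply/rowP => i; rewrite [RHS]mxE.
  have ilt : (i < n)%N by have := ltn_ord i; clear -cn; lia.
  have := colE (rshift 1 (Ordinal ilt)).
  under eq_bigr do rewrite -ycoordE yu mulrDr.
  rewrite big_split /= -mulr_suml v1 mul0r add0r (bigD1 i) //= eqxx mulr1.
  by rewrite big1 ?addr0 // => l li; rewrite val_eqE eq_sym (negPf li) mulr0.
- by rewrite ltr0n.
- by move=> i _; rewrite !xu.
- exact: ltr01.
- move=> i j ic; rewrite residueE xu yu cu mulrCA mulfV ?pnatr_eq0 // mulr1.
  have /andP[a0 a1] := b01 (j == i :> nat); have /andP[b0 b1] := b01 (j == c :> nat).
  by rewrite ler_norml; move: (_%:R) (_%:R) a0 a1 b0 b1 => a b; lra.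
- rewrite expr1n mulr1; apply: le_trans (_ : e <= _); first by rewrite lerDl.
  by rewrite exprS ler_peMr ?exprn_ege1 // (le_trans ler01).
- move=> i ic; have := congr1 (row (Ordinal (ic : i < c.+1)%N)) WF.
  by rewrite row_mul row_window row0.
- by apply: leq_trans rF _; rewrite leq_add2l.
- rewrite mulr0 expr0n (gtn_eqF n0) /=; apply: divr_gt0; first by rewrite ltr0n.
  exact: lt_le_trans e1.
- move=> j; rewrite cu; have /andP[b0 b1] := b01 (j == c :> nat).
  by move: (_%:R) b0 b1 => b; lra.
Qed.

Lemma nested_intervals (R : realType) (lo hi : nat -> R) :
  (forall s, lo s <= hi s) -> (forall s, lo s <= lo s.+1) ->
  (forall s, hi s.+1 <= hi s) -> exists x, forall s, lo s <= x <= hi s.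
Proof.
move=> lohi lo_le hi_le.
have lomono := homo_leq (@lexx _ _) (@le_trans _ _) lo_le.
have himono s t : (s <= t)%N -> hi t <= hi s.
  move=> st; rewrite -(subnKC st); elim: (t - s)%N => [|k IH]; first by rewrite addn0.
  by rewrite addnS; apply: le_trans (hi_le _) IH.
have ub s t : lo s <= hi t.
  have [st|ts] := leqP s t; first exact: le_trans (lomono _ _ st) (lohi t).
  exact: le_trans (lohi s) (himono _ _ (ltnW ts)).
have S0 : range lo !=set0 by exists (lo 0%N); exists 0%N.
exists (sup (range lo)) => s; apply/andP; split.
  apply: sup_ubound; last by exists s.
  by exists (hi 0%N) => _ [t _ <-].
by apply: ge_sup => // _ [t _ <-].
Qed.

(** It suffices to test the inclusion at the two corners of the cube where all coordinates are
    shifted by a, or all by -a. *)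
Lemma within_nested (R : realType) n (x y : 'rV[R]_n) (a b : R) : 0 <= a ->
  (forall z, within z x a -> within z y b) ->
  forall j, y 0 j - b <= x 0 j - a /\ x 0 j + a <= y 0 j + b.
Proof.
move=> a0 H j.
have W d : `|d| <= a -> within (x + const_mx d) x a.
  by move=> da l; rewrite !mxE addrAC subrr add0r.
have := H _ (W (- a) _) j; have := H _ (W a _) j.
rewrite normrN (ger0_norm a0) lexx !mxE => /(_ isT) + /(_ isT).
by rewrite !ler_norml => /andP[_ h1] /andP[h2 _]; lra.
Qed.

Lemma valid_radius_ge0 (R : realType) n c (e b : R) (s : stage R n) :
  valid c e b s -> 0 <= radius c s.
Proof.
case=> _ x0 xmono D0 _ _ _ _ _ _.
rewrite /radius divr_ge0 ?mulr_ge0 ?(ltW D0) // /top.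
suff : forall i, (i <= c)%N -> 0 <= xcoord (rpt R (pts s) i) by apply.
elim=> [|i IH] ic; first exact: ltW.
by apply: le_trans (IH (ltnW ic)) (xmono _ ic).
Qed.

(** Iteration of [stage_step] with e = E / (k + 1), b = k and B = k + 1 at stage k. The boxes are
    nested, and the starting times tend to infinity, so each late N falls between two consecutive
    ones. *)
Lemma exists_limit_point (R : realType) (n c : nat) : (c + 2 <= n)%N ->
  exists xi : 'rV[R]_n, [/\ forall j, 0 <= xi 0 j < 1,
    forall phi : 'cV[int]_(1 + n), phi != 0 ->
      xypoint 1 xi *m map_mx intr phi != 0 &
    exists E : R, 0 < E /\ forall s0 : nat, exists N0 : R, forall P, 0 < P -> N0 <= P ^+ n ->
      exists s, [/\ (s0 <= s)%N, short_points c.+1 xi P (E / s.+1%:R) &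
        confined c.+2 xi P s%:R]].
Proof.
move=> cn; have [E [s0 [E0 vs0]]] := initial_stage R cn.
pose e k : R := E / k.+1%:R.
have e_gt0 k : 0 < e k by rewrite divr_gt0.
have one0 : const_mx 1 != 0 :> 'cV[int]_(1 + n).
  by apply/eqP => /matrixP /(_ (lshift n 0) 0); rewrite !mxE.
(* An enumeration of all nonzero integer forms; codes of nothing or of 0 get the constant form 1. *)
pose phi k : 'cV[int]_(1 + n) :=
  if unpickle k is Some p then if p == 0 then const_mx 1 else p else const_mx 1.
have phi0 k : phi k != 0.
  by rewrite /phi; case: unpickle => // p; case: ifPn.
(* Validity is a premise inside the choice, so that f is total; it is restored along the iteration
   by [vst]. *)
have /choice[f fP] : forall ks : nat * stage R n, exists s' : stage R n,
    valid c (e ks.1) ks.1%:R ks.2 -> 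
    [/\ valid c (e ks.1.+1) ks.1.+1%:R s', ks.1.+1%:R <= start c s' (e ks.1.+1) &
    forall xi, within xi (center c s') (radius c s') ->
      [/\ within xi (center c ks.2) (radius c ks.2),
          xypoint 1 xi *m map_mx intr (phi ks.1) != 0 &
          forall P, 0 < P -> start c ks.2 (e ks.1) <= P ^+ n <= start c s' (e ks.1.+1) ->
            short_points c.+1 xi P (e ks.1) /\ confined c.+2 xi P ks.1%:R]].
  move=> [k s] /=; have [vs|] := pselect (valid c (e k) k%:R s); last by exists s.
  have [s' H] := stage_step k.+1%:R cn (e_gt0 k) (e_gt0 k.+1)
    (ler0n R k) (ler0n R k.+1) (phi0 k) vs.
  by exists s'.
pose st k := iteri k (fun i s => f (i, s)) s0.
have vst k : valid c (e k) k%:R (st k).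
  elim: k => [|k IH]; first by rewrite /e divr1.
  by have [] := fP (k, st k) IH.
have stP k : [/\ valid c (e k.+1) k.+1%:R (st k.+1), k.+1%:R <= start c (st k.+1) (e k.+1) &
    forall xi, within xi (center c (st k.+1)) (radius c (st k.+1)) ->
      [/\ within xi (center c (st k)) (radius c (st k)),
          xypoint 1 xi *m map_mx intr (phi k) != 0 &
          forall P, 0 < P -> start c (st k) (e k) <= P ^+ n <= start c (st k.+1) (e k.+1) ->
            short_points c.+1 xi P (e k) /\ confined c.+2 xi P k%:R]].
  exact: fP (k, st k) (vst k).
clearbody st.
have rad0 k : 0 <= radius c (st k) := valid_radius_ge0 (vst k).
have nest k := within_nested (rad0 k.+1) (fun z zk =>
  let: And3 h _ _ := (let: And3 _ _ H := stP k in H z zk) in h).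
have /choice[x xP] : forall j, exists x, forall k,
    center c (st k) 0 j - radius c (st k) <= x <= center c (st k) 0 j + radius c (st k).
  move=> j; apply: nested_intervals => k.
  - by have := rad0 k; lra.
  - by have [] := nest k j.
  - by have [] := nest k j.
pose xi : 'rV[R]_n := \row_j x j.
have xin k : within xi (center c (st k)) (radius c (st k)).
  by move=> j; have := xP j k; rewrite [xi 0 j]mxE ler_norml; lra.
have start_ge k : (0 < k)%N -> k%:R <= start c (st k) (e k).
  by case: k => // k _; have [] := stP k.
exists xi; split.
- move=> j; have [h1 h2] := valid_box (vst 0%N) j.
  by have := xP j 0%N; rewrite [xi 0 j]mxE; lra.
- move=> p p0; have <- : phi (pickle p) = p by rewrite /phi pickleK (negPf p0).
  by move: (pickle p) => k; have [_ _ /(_ _ (xin k.+1)) []] := stP k.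
exists E; split=> // s1; exists (start c (st s1) (e s1)) => P P0 PN.
pose J := (s1 + (Num.truncn (P ^+ n)).+1)%N.
have [JP|[k [/andP[k1 _] kP Pk]]] :=
    interval_index (x := fun k => start c (st k) (e k)) (leq_addr _ s1 : (s1 <= J)%N) PN.
  have := le_trans (start_ge J _) JP; rewrite /J addnS => /(_ isT).
  rewrite leNgt => /negP[]; apply: lt_le_trans (truncnS_gt _) _.
  by rewrite ler_nat ltnS leq_addl.
exists k; have [_ _ /(_ _ (xin k.+1)) [_ _ /(_ P P0)]] := stP k.
by rewrite kP Pk => /(_ isT) [].
Qed.

(** * The limits of the successive minima *)

Theorem theorem1 (R : realType) (n k : nat) (hk1 : (1 <= k)%N)
    (hkn : (k <= n - 1)%N) :
  exists eta : 'rV[R]_n,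
    (forall j : 'I_n, 0 <= eta 0 j < 1) /\
    let xi := xypoint 1 eta in
    [/\ lin_indep_int xi,
        mu k xi N @[N --> +oo] --> (0 : R)
      & mu (k + 2) xi N @[N --> +oo] --> +oo].
Proof.
case: k hk1 hkn => // c _ cn1; have cn : (c + 2 <= n)%N by lia.
have n0 : (0 < n)%N by lia.
have [eta [box indep [E [E0 HE]]]] := exists_limit_point R cn.
have H s0 : exists N0 : R, forall N, N0 < N -> exists s, [/\ (s0 <= s)%N, 0 < N,
    short_points c.+1 eta (N `^ n%:R^-1) (E / s.+1%:R) &
    confined c.+2 eta (N `^ n%:R^-1) s%:R].
  have [N0 HN] := HE s0; exists (Num.max 0 N0) => N.
  rewrite gt_max => /andP[N_gt0 NN]; have [||s [? ? ?]] := HN (N `^ n%:R^-1).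
  - exact: powR_gt0.
  - by rewrite powR_root // ltW.
  - by exists s.
exists eta; split=> //; split.
- move=> a; apply: contra_eq => a0.
  have /indep : a^T != 0 by rewrite -trmx_eq0 trmxK.
  apply: contra => /eqP s0; apply/eqP/matrixP => i j; rewrite !ord1 !mxE -[RHS]s0.
  by apply: eq_bigr => l _; rewrite !mxE mulrC.
- apply/cvgrPdist_le => d d0.
  have [N0 HN] := H (Num.truncn (n%:R * E / d)).
  exists N0; split=> [|N /HN [s [ds N_gt0 sp _]]]; first exact: num_real.
  rewrite sub0r normrN ger0_norm ?mu_ge0 //.
  have es0 : 0 < E / s.+1%:R by rewrite divr_gt0.
  apply: le_trans (mu_le_short n0 N_gt0 es0 sp) _.
  rewrite mulrA ler_pdivrMr // [leRHS]mulrC -ler_pdivrMr //.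
  by apply: le_trans (ltW (truncnS_gt _)) _; rewrite ler_nat ltnS.
- apply/cvgryPge => A; have [N0 HN] := H (Num.truncn A).+1.
  exists N0; split=> [|N /HN [s [As N_gt0 _ cf]]]; first exact: num_real.
  (* With k = c + 1, the index k + 2 = c + 3 exceeds the dimension bound c + 2 by one and is at most
     n + 1. *)
  apply: le_trans (mu_ge_confined n0 N_gt0 _ cf); last by lia.
  by apply: le_trans (ltW (truncnS_gt _)) _; rewrite ler_nat.
Qed.
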